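(* Let $f,g,h,\gamma$ and $\mathcal{X}=\operatorname{dom}(g)\subseteq\mathbb{R}^n$ satisfy the standing assumptions (A1)-(A4) and (G1)-(G4) of the context, with constant $\overline t>0$ from (G3), and let $t\in(0,\overline t)$. Let $\overline{\boldsymbol z}\in\mathcal{X}$. Then the following two statements are equivalent: (i) For every sequence $\{\boldsymbol z^k\}_{k\in\mathbb{N}}\subset \operatorname{int}(\operatorname{dom} h)\cap\mathcal{X}$ with $\boldsymbol z^k\to\overline{\boldsymbol z}$, we have $\lim_{k\to\infty}R^t_\gamma(\boldsymbol z^k)=0$. (ii) $\boldsymbol 0\in\nabla_{\mathcal{M}(\overline{\boldsymbol z})}f(\overline{\boldsymbol z})+\partial_{\mathcal{M}(\overline{\boldsymbol z})}g(\overline{\boldsymbol z})$.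
   Context: Problem: minimize $F(\boldsymbol x):=f(\boldsymbol x)+g(\boldsymbol x)$ over $\boldsymbol x\in\mathbb{R}^n$, with $f:\mathbb{R}^n\to\mathbb{R}$ and $g:\mathbb{R}^n\to\overline{\mathbb{R}}$ (extended-real-valued). Separable kernel function: $h:\mathbb{R}^n\to\overline{\mathbb{R}}$ is a separable kernel function if (1) $h(\boldsymbol x)=\sum_{i=1}^n\varphi(x_i)$ for some $\varphi:\mathbb{R}\to\overline{\mathbb{R}}$ that is continuously differentiable on $\operatorname{int}(\operatorname{dom}\varphi)$; (2) for every sequence $\{x^k\}\subset\operatorname{int}(\operatorname{dom}\varphi)$ converging to a point of $\operatorname{bd}(\operatorname{dom}\varphi)$, $|\varphi'(x^k)|\to+\infty$; (3) $\varphi$ is strictly convex. Bregman divergences: $D_h(\boldsymbol y,\boldsymbol x)=h(\boldsymbol y)-h(\boldsymbol x)-\nabla h(\boldsymbol x)^\top(\boldsymbol y-\boldsymbol x)$ for $\boldsymbol x\in\operatorname{int}(\operatorname{dom} h)$ (equal to $+\infty$ if $\boldsymbol y\notin\operatorname{dom} h$). Standing assumptions on the problem: $\operatorname{dom}(g)=\mathcal{X}$ is a nonempty closed convex set and (A1) $f$ is continuously differentiable on $\mathcal{X}$; (A2) $g$ is convex and locally Lipschitz continuous on $\mathcal{X}$; (A3) $\operatorname{int}(\operatorname{dom} h)\cap\mathcal{X}\neq\emptyset$ and $\mathcal{X}\subseteq\operatorname{cl}(\operatorname{dom} h)$; (A4) $h$ is a separable kernel function. Standing assumptions on the surrogate model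 $\gamma(\cdot;\cdot)$ ($\nabla\gamma(\boldsymbol y;\boldsymbol x)$ denotes the gradient in $\boldsymbol y$): (G1) $(\boldsymbol x,\boldsymbol y)\mapsto\gamma(\boldsymbol y;\boldsymbol x)$ and $(\boldsymbol x,\boldsymbol y)\mapsto\nabla\gamma(\boldsymbol y;\boldsymbol x)$ are jointly continuous for $\boldsymbol y\in\mathcal{X}$, $\boldsymbol x\in\mathcal{X}$; (G2) for all $\boldsymbol x\in\mathcal{X}$, $\nabla\gamma(\boldsymbol y;\boldsymbol x)|_{\boldsymbol y=\boldsymbol x}=\nabla f(\boldsymbol x)$ and $\gamma(\boldsymbol x;\boldsymbol x)=f(\boldsymbol x)$; (G3) there is a constant $\overline t>0$ such that for all $\boldsymbol x\in\mathcal{X}$ the function $\overline t(\gamma(\cdot;\boldsymbol x)+g(\cdot))+h(\cdot)$ is strictly convex; (G4) either $\mathcal{X}$ is compact, or for all $t\in(0,\overline t]$ and all sequences $\{\boldsymbol z^k\},\{\boldsymbol y^k\}\subseteq\operatorname{int}(\operatorname{dom} h)\cap\mathcal{X}$ with $\|\boldsymbol y^k\|\to+\infty$ and $\boldsymbol z^k\to\overline{\boldsymbol z}\in\mathcal{X}$, $\lim_{k\to\infty}\gamma(\boldsymbol y^k;\boldsymbol z^k)+g(\boldsymbol y^k)+\frac1tD_h(\boldsymbol y^k,\boldsymbol z^k)=+\infty$. Update map and residual: for $\boldsymbol x\in\operatorname{int}(\operatorname{dom} h)\cap\mathcal{X}$, $T^t_\gamma(\boldsymbol x):=\operatorname{argmin}_{\boldsymbol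 y\in\mathcal{X}}\{\gamma(\boldsymbol y;\boldsymbol x)+g(\boldsymbol y)+\frac1tD_h(\boldsymbol y,\boldsymbol x)\}$ (a single point, lying in $\operatorname{int}(\operatorname{dom} h)\cap\mathcal{X}$), and $R^t_\gamma(\boldsymbol x):=D_h(T^t_\gamma(\boldsymbol x),\boldsymbol x)$. Affine manifold: $\mathcal{B}(\boldsymbol x)=\{b\in[n]:x_b\in\operatorname{bd}(\operatorname{dom}\varphi)\}$, $\mathcal{M}(\boldsymbol x)=\{\boldsymbol y\in\mathbb{R}^n:\boldsymbol y_{\mathcal{B}(\boldsymbol x)}=\boldsymbol x_{\mathcal{B}(\boldsymbol x)}\}$, with tangent space $T_{\mathcal{M}(\boldsymbol x)}=\{\boldsymbol v\in\mathbb{R}^n:\boldsymbol v_{\mathcal{B}(\boldsymbol x)}=\boldsymbol 0\}$. For $\boldsymbol u\in\mathcal{M}(\boldsymbol x)$: $\nabla_{\mathcal{M}(\boldsymbol x)}f(\boldsymbol u):=\operatorname{proj}_{T_{\mathcal{M}(\boldsymbol x)}}(\nabla f(\boldsymbol u))$ and $\partial_{\mathcal{M}(\boldsymbol x)}g(\boldsymbol u):=\{\boldsymbol v\in T_{\mathcal{M}(\boldsymbol x)}:g(\boldsymbol y)-g(\boldsymbol u)\ge\boldsymbol v^\top(\boldsymbol y-\boldsymbol u)\ \forall\boldsymbol y\in\mathcal{M}(\boldsymbol x)\}$. *)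

(* Defs.v *)
From HB Require Import structures.
From mathcomp Require Import all_boot all_order all_algebra.
From mathcomp Require Import all_classical all_reals all_analysis.
Set Implicit Arguments.
Unset Strict Implicit.
Unset Printing Implicit Defensive.
Import Order.TTheory GRing.Theory Num.Theory.
Import numFieldNormedType.Exports.
Local Open Scope classical_set_scope.
Local Open Scope ring_scope.

Definition edom {R : realType} {T : Type} (F : T -> \bar R) : set T :=
  [set x | (F x < +oo)%E].

Definition bd {T : topologicalType} (A : set T) : set T := closure A `\` A°.

Definition dot {R : realType} {n : nat} (u v : 'rV[R]_n) : R :=
  \sum_(i < n) u 0 i * v 0 i.

Definition grad {R : realType} {n : nat} (F : 'rV[R]_n -> R) (x : 'rV[R]_n) :
  'rV[R]_n := \row_(i < n) 'D_('e_i) F x.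

(* The set [S] need not be open or have interior points: differentiability is
   the ambient one (in R^n) at each point of [S], and the gradient is continuous
   relatively to [S]. *)
Definition continuously_differentiable_on {R : realType} {n : nat}
    (S : set 'rV[R]_n) (F : 'rV[R]_n -> R) : Prop :=
  (forall x, S x -> differentiable F x) /\ {within S, continuous (grad F)}.

Definition econvex {R : realType} {V : lmodType R} (F : V -> \bar R) : Prop :=
  forall (x y : V) (l : R), edom F x -> edom F y -> 0 < l < 1 ->
    (F (l *: x + (1 - l) *: y)%R <= l%:E * F x + (1 - l)%R%:E * F y)%E.

(* The strict inequality excludes the value -oo on [edom F] as soon as [edom F]
   has at least two points. *)
Definition strictly_econvex {R : realType} {V : lmodType R} (F : V -> \bar R) :
    Prop :=
  forall (x y : V) (l : R), edom F x -> edom F y -> x != y -> 0 < l < 1 ->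
    (F (l *: x + (1 - l) *: y)%R < l%:E * F x + (1 - l)%R%:E * F y)%E.

Definition elocally_lipschitz_on {R : realType} {n : nat} (S : set 'rV[R]_n)
    (F : 'rV[R]_n -> \bar R) : Prop :=
  (forall x, S x -> F x \is a fin_num) /\
  [locally [lipschitz fine (F x) | x in S]].

Definition separable_kernel {R : realType} {n : nat} (phi : R -> \bar R)
    (h : 'rV[R]_n -> \bar R) : Prop :=
  [/\ (forall x, h x = (\sum_(i < n) phi (x 0%R i))%E),
      (forall s, (edom phi)° s ->
         derivable (fine \o phi) s 1 /\
         {for s, continuous (derive1 (fine \o phi))}),
      (forall (u : nat -> R) (a : R), (forall k, (edom phi)° (u k)) ->
         bd (edom phi) a -> u @ \oo --> a ->
         `|derive1 (fine \o phi) (u k)| @[k --> \oo] --> +oo)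
    & strictly_econvex (phi : R^o -> \bar R)].

(* Meaningful for [x] in the interior of [edom h], where [h] is finite; the
   value is then +oo when [y] is outside [edom h]. *)
Definition bregman {R : realType} {n : nat} (h : 'rV[R]_n -> \bar R)
    (y x : 'rV[R]_n) : \bar R :=
  (h y - h x - (dot (grad (fine \o h) x) (y - x)%R)%:E)%E.

Definition argmin {R : realType} {T : Type} (S : set T) (F : T -> \bar R) :
  set T := [set y | S y /\ forall u, S u -> (F y <= F u)%E].

Section Surrogate.
Context {R : realType} {n : nat}.
(* [gamma y x] stands for gamma(y; x): the model in [y], built at [x]. *)
Implicit Types (X : set 'rV[R]_n) (gamma : 'rV[R]_n -> 'rV[R]_n -> R)
  (g h : 'rV[R]_n -> \bar R) (f : 'rV[R]_n -> R) (t : R).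

Definition surrogate_continuous X gamma : Prop :=
  [/\ (forall x y, X x -> X y -> differentiable (gamma ^~ x) y),
      {within X `*` X, continuous
         (fun p : 'rV[R]_n * 'rV[R]_n => gamma p.2 p.1)}
    & {within X `*` X, continuous
         (fun p : 'rV[R]_n * 'rV[R]_n => grad (gamma ^~ p.1) p.2)}].

Definition surrogate_consistent X f gamma : Prop :=
  forall x, X x -> grad (gamma ^~ x) x = grad f x /\ gamma x x = f x.

Definition surrogate_strictly_convex X g h gamma t : Prop :=
  forall x, X x -> strictly_econvex
    (fun y : 'rV[R]_n => t%:E * ((gamma y x)%:E + g y) + h y)%E.

Definition subproblem g h gamma t (x y : 'rV[R]_n) : \bar R :=
  ((gamma y x)%:E + g y + (t^-1)%R%:E * bregman h y x)%E.

Definition surrogate_coercive X g h gamma (tbar : R) : Prop :=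
  compact X \/
  forall (t : R) (z y : nat -> 'rV[R]_n) (zbar : 'rV[R]_n),
    0 < t <= tbar ->
    (forall k, ((edom h)° `&` X) (z k)) ->
    (forall k, ((edom h)° `&` X) (y k)) ->
    `|y k| @[k --> \oo] --> +oo ->
    X zbar -> z @ \oo --> zbar ->
    subproblem g h gamma t (z k) (y k) @[k --> \oo] --> +oo%E.

Definition update X g h gamma t (x : 'rV[R]_n) : 'rV[R]_n :=
  get (argmin X (subproblem g h gamma t x)).

Definition residual X g h gamma t (x : 'rV[R]_n) : \bar R :=
  bregman h (update X g h gamma t x) x.

End Surrogate.

Section Manifold.
Context {R : realType} {n : nat} (phi : R -> \bar R).
Implicit Types x u : 'rV[R]_n.

Definition bd_index x : set 'I_n := [set b | bd (edom phi) (x 0 b)].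

Definition manifold x : set 'rV[R]_n :=
  [set y | forall b, bd_index x b -> y 0 b = x 0 b].

Definition tangent x : set 'rV[R]_n :=
  [set v | forall b, bd_index x b -> v 0 b = 0].

(* Euclidean projection; [`| _ |] on ['rV[R]_n] is the maximum norm, hence the
   use of [dot]. *)
Definition euclidean_proj (S : set 'rV[R]_n) (w : 'rV[R]_n) : 'rV[R]_n :=
  get (argmin S (fun p => (dot (w - p) (w - p))%:E)).

Definition manifold_grad x (f : 'rV[R]_n -> R) u : 'rV[R]_n :=
  euclidean_proj (tangent x) (grad f u).

Definition manifold_subdiff x (g : 'rV[R]_n -> \bar R) u : set 'rV[R]_n :=
  [set v | tangent x v /\
     forall y, manifold x y -> ((dot v (y - u)%R)%:E <= g y - g u)%E].

End Manifold.

(* Main.v *)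
(** The proof compares function values only and never differentiates the update.

    Write [y = T(z)], let [D] be the Bregman divergence and [P = gamma + g].  Along
    a subsequence [y^k] converges (coercivity), and the coordinates of the limit
    that sit at boundary coordinates of [zbar] are those of [zbar]: the three-point
    inequality [(phi'(w) - phi'(z)) (y - w) <= D(y, z)] would otherwise make [D]
    blow up.

    (ii) => (i).  Convexity of [tbar P + h] and minimality of [y] give
    [l (1/t - 1/tbar) D(y, z) <= P(z) - P(z + l (y - z))] for [0 < l < 1].  Let
    [k -> oo], divide by [l] and let [l -> 0]: by (ii) the right-hand side has a
    nonpositive limit.

    (i) => (ii).  Given [u] in the manifold and an interior point [x0], take
    [z = zbar + e (x0 - zbar)] and [v = u + e (x0 - u)], so that [z] and [v] agree
    in the boundary coordinates.  Comparing [y] with [y + l (v - y)], these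
    coordinates contribute terms of a favourable sign (monotonicity of [phi']),
    and the others vanish to first order in [l] because [phi'] is continuous. *)

Require Import Defs.
From HB Require Import structures.
From mathcomp Require Import all_boot all_order all_algebra.
From mathcomp Require Import all_classical all_reals all_analysis.
From mathcomp Require Import ring lra.
Set Implicit Arguments.
Unset Strict Implicit.
Unset Printing Implicit Defensive.
Import Order.TTheory GRing.Theory Num.Theory.
Import numFieldNormedType.Exports.
Local Open Scope classical_set_scope.
Local Open Scope ring_scope.

(** * Sequences and line segments *)

(** Points of [I] close to [a] and [b] still bracket [c], and by convexity everything between them,
    a neighbourhood of [c], lies in [I]. *)
Lemma closure_between (R : realType) (I : set R) (a b c : R)
  (convI : forall x y l, I x -> I y -> 0 < l < 1 -> I (l * x + (1 - l) * y)) :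
  closure I a -> closure I b -> a < c < b -> I° c.
Proof.
move=> clIa clIb /andP[ac cb].
have [a' [Ia' a'c]] : exists a', I a' /\ a' < c.
  have /clIa[a' [Ia' a'c]] : nbhs a [set x | x < c] by exact: lt_nbhsl.
  by exists a'.
have [b' [Ib' cb']] : exists b', I b' /\ c < b'.
  have /clIb[b' [Ib' cb']] : nbhs b [set x | c < x] by exact: lt_nbhsr.
  by exists b'.
rewrite /interior; near=> s.
have a's : a' < s by near: s; exact: lt_nbhsr.
have sb' : s < b' by near: s; exact: lt_nbhsl.
have ba0 : 0 < b' - a' by rewrite subr_gt0 (lt_trans a's).
have -> : s = (b' - s) / (b' - a') * a' + (1 - (b' - s) / (b' - a')) * b'.
  by field; rewrite gt_eqF.
apply: convI => //; apply/andP; split; first by rewrite divr_gt0// subr_gt0.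
by rewrite ltr_pdivrMr// mul1r ltrD2l ltrN2.
Unshelve. all: by end_near. Qed.

Lemma within_continuous_cvg (T U : topologicalType) (A : set T) (F : T -> U)
    (u : nat -> T) (a : T) :
  {within A, continuous F} -> A a -> (forall k, A (u k)) -> u @ \oo --> a ->
  F (u k) @[k --> \oo] --> F a.
Proof.
move=> cF Aa Au ua P /(cF a) FP.
have {FP} : within A (nbhs a) (F @^-1` P) by rewrite (nbhs_subspace_in Aa).
by move=> /ua; apply: (@filterS _ \oo) => k; exact.
Qed.

(** Extraction is encoded by [k <= s k] rather than by monotonicity: such an [s] tends to infinity,
    comes straight from choice and composes well. *)
Lemma cvg_subseq (T : topologicalType) (u : nat -> T) (a : T) (s : nat -> nat) :
  (forall k, (k <= s k)%N) -> u @ \oo --> a -> u (s k) @[k --> \oo] --> a.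
Proof.
move=> sge ua; apply: (cvg_trans _ ua) => P [N _ NP]; exists N => // k /= Nk.
by apply: NP => /=; exact: leq_trans Nk (sge k).
Qed.

Lemma frequently_subseq (P : nat -> Prop) : ~ (\forall k \near \oo, ~ P k) ->
  exists s : nat -> nat, (forall k, (k <= s k)%N) /\ forall k, P (s k).
Proof.
move=> nP; have freqP N : exists m, (N <= m)%N /\ P m.
  apply: contrapT => H; apply: nP; exists N => // m /= Nm Pm.
  by apply: H; exists m.
have [s sP] := choice freqP.
by exists s; split=> k; have [] := sP k.
Qed.

(** Bolzano-Weierstrass: the compact ball contains a cluster point, and the indices are chosen
    within [k.+1%:R^-1] of it. *)
Lemma bounded_subseq (R : realType) (n : nat) (u : nat -> 'rV[R]_n) (M : R) :
  (forall k, `|u k| <= M) ->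
  exists (s : nat -> nat) (a : 'rV[R]_n),
    (forall k, (k <= s k)%N) /\ u (s k) @[k --> \oo] --> a.
Proof.
move=> uM.
have cK : compact [set x : 'rV[R]_n | `|x| <= M].
  apply: bounded_closed_compact.
    by exists M; split; [exact: num_real|move=> x Mx y /= /le_trans -> //; exact: ltW].
  apply: (@closed_comp _ _ (fun x : 'rV[R]_n => `|x|) [set r | r <= M]).
    by move=> x _; exact: norm_continuous.
  exact: closed_le.
have uK : (u @ \oo) [set x : 'rV[R]_n | `|x| <= M].
  by exists 0%N => // k _ /=; exact: uM.
have [a [_ cla]] := cK (u @ \oo) _ uK.
have /choice[s sP] : forall k, exists m, (k <= m)%N /\ `|a - u m| < k.+1%:R^-1.
  move=> k.
  have [|| _ [[m km <-] am]] := cla (u @` [set m | (k <= m)%N]) (ball a k.+1%:R^-1).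
  - by exists k => // m km; exists m.
  - by apply: nbhsx_ballx; rewrite invr_gt0.
  - by exists m; split=> //; move: am; rewrite -ball_normE.
exists s, a; split; first by move=> k; have [] := sP k.
apply/cvgrPdist_lt => e e0.
have := @cvg_harmonic R; move/cvgrPdist_lt => /(_ e e0); apply: filterS => k.
rewrite sub0r normrN /= ger0_norm ?invr_ge0// => ke.
by apply: lt_trans ke; have [] := sP k.
Qed.

Lemma derive_cvg_seq (R : realType) (V : normedModType R) (F : V -> R) (x d : V)
    (l : nat -> R) :
  derivable F x d -> l @ \oo --> (0 : R) -> (forall k, l k != 0) ->
  (F (x + l k *: d) - F x) / l k @[k --> \oo] --> 'D_d F x.
Proof.
move=> dF l0 ln0.
have H : (fun r => r^-1 *: (F (r *: d + x) - F x)) @ 0^' --> 'D_d F x := dF.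
have -> : (fun k => (F (x + l k *: d) - F x) / l k) =
  (fun r => r^-1 *: (F (r *: d + x) - F x)) \o l.
  by apply/funext => k /=; rewrite [RHS]mulrC (addrC x).
apply: cvg_comp H => P [e e0 eP].
move/cvgrPdist_lt : l0 => /(_ e e0); apply: filterS => k /= le.
by apply: eP => //=; exact: ln0.
Qed.

Lemma cvg_coord (R : realType) (n : nat) (u : nat -> 'rV[R]_n) (a : 'rV[R]_n)
    (i : 'I_n) : u @ \oo --> a -> u k 0 i @[k --> \oo] --> a 0 i.
Proof.
by move=> ua; apply: (cvg_comp _ (fun x : 'rV[R]_n => x 0 i) ua); exact: coord_continuous.
Qed.

(** The shift by two keeps every step, including the first, strictly between 0 and 1, where the
    convexity hypotheses apply. *)
Lemma cvg_invnatS2 (R : realType) : (fun k : nat => k.+2%:R^-1 : R) @ \oo --> (0 : R).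
Proof. by have /= := @cvg_harmonic R; rewrite -cvg_shiftS. Qed.

Lemma invnatS2_itv (R : realType) (k : nat) : 0 < (k.+2%:R^-1 : R) < 1.
Proof. by rewrite invr_gt0 ltr0n invf_lt1 ?ltr1n. Qed.

Lemma ler_cvg_seq (R : realType) (u v : nat -> R) (a b : R) :
  u @ \oo --> a -> v @ \oo --> b -> (forall k, u k <= v k) -> a <= b.
Proof. by move=> ua vb uv; apply: (ler_cvg_to ua vb); apply: nearW. Qed.

Lemma cvg_sum_seq (R : realType) (n : nat) (u : 'I_n -> nat -> R) (a : 'I_n -> R) :
  (forall i, u i @ \oo --> a i) ->
  (\sum_(i < n) u i k) @[k --> \oo] --> \sum_(i < n) a i.
Proof.
by move=> ua; apply: cvg_big => //; exact: add_continuous.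
Qed.

Lemma cvg_seg (R : realType) (V : normedModType R) (x y : nat -> V) (a b : V) (l : R) :
  x @ \oo --> a -> y @ \oo --> b ->
  x k + l *: (y k - x k) @[k --> \oo] --> a + l *: (b - a).
Proof.
move=> xa yb; apply: cvgD => //; apply: cvgZ; [exact: cvg_cst|exact: cvgB].
Qed.

Lemma cvg_seg_param (R : realType) (V : normedModType R) (a b : V) (l : nat -> R) :
  l @ \oo --> (0 : R) -> a + l k *: (b - a) @[k --> \oo] --> a.
Proof.
move=> l0; rewrite -[X in _ --> X]addr0 -(scale0r (b - a)).
by apply: cvgD; [exact: cvg_cst|apply: cvgZ => //; exact: cvg_cst].
Qed.

(** * One-dimensional kernels *)

Section Kernel1D.
Context {R : realType} (I : set R) (p dp : R -> R).
Context (p_conv : forall x y l : R, I x -> I y -> x != y -> 0 < l < 1 ->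
  I (l * x + (1 - l) * y) /\ p (l * x + (1 - l) * y) < l * p x + (1 - l) * p y).
Context (p_der : forall s : R, I° s -> derivable p s 1 /\ 'D_1 p s = dp s).
Context (dp_cont : forall s : R, I° s -> {for s, continuous dp}).
Context (dp_infty : forall (u : nat -> R) (a : R), (forall k, I° (u k)) ->
  bd I a -> u @ \oo --> a -> `|dp (u k)| @[k --> \oo] --> +oo).

(** The kernel is handled through real functions: [I], [p] and [dp] are later [edom phi],
    [fine \o phi] and [derive1 (fine \o phi)]. *)
Definition bregman1 (u s : R) : R := p u - p s - dp s * (u - s).

Let int_sub (s : R) : I° s -> I s := @interior_subset _ I s.

Lemma dom_convex (x y l : R) : I x -> I y -> 0 < l < 1 -> I (l * x + (1 - l) * y).
Proof.
move=> Ix Iy l01; have [->|xy] := eqVneq x y; last by have [] := p_conv Ix Iy xy l01.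
by rewrite -mulrDl addrC subrK mul1r.
Qed.

Lemma kernel_convex (x y l : R) : I x -> I y -> 0 < l < 1 ->
  p (l * x + (1 - l) * y) <= l * p x + (1 - l) * p y.
Proof.
move=> Ix Iy l01; have [->|xy] := eqVneq x y.
  by rewrite -!mulrDl addrC subrK !mul1r.
by apply: ltW; have [] := p_conv Ix Iy xy l01.
Qed.

(** For [a != x] the new point is strictly between two closure points of a convex set. This is how
    boundary points are approached from inside. *)
Lemma interior_segment (a x l : R) : closure I a -> I° x -> 0 < l < 1 ->
  I° (a + l * (x - a)).
Proof.
move=> clIa Ix /andP[l0 l1].
have clIx : closure I x by apply: subset_closure; exact: int_sub.
have [ax|xa|->] := ltgtP a x; last by rewrite subrr mulr0 addr0.
- apply: (closure_between dom_convex clIa clIx); apply/andP; split; nra.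
- apply: (closure_between dom_convex clIx clIa); apply/andP; split; nra.
Qed.

(** Gradient inequality: convexity bounds the difference quotients at [s] towards [u] by
    [p u - p s], and they tend to [dp s * (u - s)]. *)
Lemma bregman1_ge0 (u s : R) : I u -> I° s -> 0 <= bregman1 u s.
Proof.
move=> Iu Is; rewrite /bregman1 subr_ge0.
have [->|us] := eqVneq u s; first by rewrite !subrr mulr0.
have [dps dpE] := p_der Is.
have us0 : u - s != 0 by rewrite subr_eq0.
(* The derivative is the one in direction 1, so the step carries the factor [u - s], which is
   multiplied back in the limit. *)
have l0 : (fun k => (k.+2%:R^-1 : R) * (u - s)) @ \oo --> (0 : R).
  rewrite -(mul0r (u - s)); apply: (cvgM _ (cvg_cst _)); exact: cvg_invnatS2.
have ln0 k : (k.+2%:R^-1 : R) * (u - s) != 0 :> R by rewrite mulf_neq0// invr_eq0.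
have H := derive_cvg_seq dps l0 ln0; rewrite dpE in H.
apply: (ler_cvg_seq (cvgM H (cvg_cst (u - s))) (cvg_cst (p u - p s))) => k /=.
set l : R := k.+2%:R^-1.
have l01 : 0 < l < 1 := invnatS2_itv R k.
have := kernel_convex Iu (int_sub Is) l01.
have -> : l * u + (1 - l) * s = s + (l * (u - s))%:A by rewrite [_%:A]mulr1; ring.
move: l01 => /andP[lgt0 _] Hl.
rewrite invfM mulrA mulfVK// ler_pdivrMr//; lra.
Qed.

(** At the midpoint of [u] and [s] the divergence is nonnegative, while strict convexity puts [p]
    strictly below the chord there. *)
Lemma bregman1_gt0 (u s : R) : I u -> I° s -> u != s -> 0 < bregman1 u s.
Proof.
move=> Iu Is us.
have h01 : 0 < (2^-1 : R) < 1 by rewrite invr_gt0 ltr0n invf_lt1 ?ltr1n.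
have [Im pm] := p_conv Iu (int_sub Is) us h01.
have := bregman1_ge0 Im Is; rewrite /bregman1; move: pm; set m := _ + _ => pm.
have -> : m - s = (u - s) / 2 by rewrite /m; field.
lra.
Qed.

(** The product is the sum of the divergences [bregman1 a b] and [bregman1 b a]. *)
Lemma dp_mono (a b : R) : I° a -> I° b -> 0 <= (dp a - dp b) * (a - b).
Proof.
move=> Ia Ib; have := bregman1_ge0 (int_sub Ia) Ib.
by have := bregman1_ge0 (int_sub Ib) Ia; rewrite /bregman1; nra.
Qed.

Lemma dp_strict_mono (a b : R) : I° a -> I° b -> a != b ->
  0 < (dp a - dp b) * (a - b).
Proof.
move=> Ia Ib ab; have := bregman1_gt0 (int_sub Ia) Ib ab.
by have := bregman1_ge0 (int_sub Ib) Ia; rewrite /bregman1; nra.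
Qed.

(** By the identity [bregman1 u s = bregman1 u w + bregman1 w s + (dp w - dp s) * (u - w)], whose
    first two terms are nonnegative. *)
Lemma three_point (u w s : R) : I u -> I° w -> I° s ->
  (dp w - dp s) * (u - w) <= bregman1 u s.
Proof.
move=> Iu Iw Is; have := bregman1_ge0 (int_sub Iw) Is.
by have := bregman1_ge0 Iu Iw; rewrite /bregman1; nra.
Qed.

(** The same identity, dropping only [bregman1 u w]. The slope is taken at the new point [w], so
    that [u] may lie on the boundary. *)
Lemma bregman1_diff (u w s : R) : I u -> I° w -> I° s ->
  bregman1 w s - bregman1 u s <= (dp w - dp s) * (w - u).
Proof.
by move=> Iu Iw Is; have := bregman1_ge0 Iu Iw; rewrite /bregman1; nra.
Qed.

Lemma dp_cvg (u : nat -> R) (a : R) : I° a -> u @ \oo --> a ->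
  dp (u k) @[k --> \oo] --> dp a.
Proof. by move=> Ia ua; apply: (cvg_comp _ dp ua); exact: dp_cont. Qed.

(* Monotonicity of [dp] forces the sign of the blow-up: towards a boundary point
   [a], [dp] points away from the interior. *)
Lemma dp_blowup (q s : nat -> R) (a w c : R) : bd I a -> I° w ->
  (forall k, I° (q k)) -> q @ \oo --> a -> s @ \oo --> c -> 0 < c * (w - a) ->
  dp (q k) * s k @[k --> \oo] --> -oo.
Proof.
move=> bda Iw Iq qa sc cw.
have dpoo := dp_infty Iq bda qa.
have wq : (w - q k) @[k --> \oo] --> w - a by apply: cvgB => //; exact: cvg_cst.
have swq : s k * (w - q k) @[k --> \oo] --> c * (w - a) by exact: cvgM.
have dwq : dp w * (w - q k) @[k --> \oo] --> dp w * (w - a) by apply: cvgM => //; exact: cvg_cst.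
have nwq : `|w - q k| @[k --> \oo] --> `|w - a| by exact: cvg_norm.
have ns : `|s k| @[k --> \oo] --> `|c| by exact: cvg_norm.
have c0 : 0 < `|c| by rewrite normr_gt0; apply: contraTneq cw => ->; rewrite mul0r ltxx.
have wa0 : 0 < `|w - a|.
  by rewrite normr_gt0; apply: contraTneq cw => ->; rewrite mulr0 ltxx.
apply/cvgrNyPle => A.
near=> k.
have h1 : 0 < s k * (w - q k) by near: k; exact: cvgr_gt swq _ cw.
have h2 : dp w * (w - q k) <= dp w * (w - a) + 1.
  by near: k; apply: cvgr_le dwq _ _; rewrite ltrDl.
have h3 : `|w - a| / 2 <= `|w - q k|.
  by near: k; apply: cvgr_ge nwq _ _; rewrite gtr_pMr ?invf_lt1 ?ltr1n.
have h4 : `|c| / 2 <= `|s k| by near: k; apply: cvgr_ge ns _ _; rewrite gtr_pMr ?invf_lt1 ?ltr1n.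
(* The first summand beats the upper bound given by monotonicity and so fixes the sign; the second
   brings the product below [A]. *)
have h5 : (`|dp w * (w - a)| + 2) / (`|w - a| / 2) + `|A| / (`|c| / 2) <= `|dp (q k)|.
  by near: k; exact: cvgry_ge dpoo _.
have := dp_mono Iw (Iq k) => h6.
have e0 : 0 < `|w - a| / 2 by rewrite divr_gt0.
have e1 : 0 < `|c| / 2 by rewrite divr_gt0.
move: h3 h4 h5 e0 e1; set e := `|w - a| / 2; set f := `|c| / 2 => h3 h4 h5 e0 e1.
(* By [h6] and [h2] this product is at most [dp w * (w - a) + 1]; were it nonnegative, it would be
   at least [|dp (q k)| * e], which is larger. *)
have dv : dp (q k) * (w - q k) < 0.
  rewrite ltNge; apply/negP => h7.
  have : `|dp (q k)| * e <= dp (q k) * (w - q k).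
    by rewrite -(ger0_norm h7) normrM ler_wpM2l.
  have : (`|dp w * (w - a)| + 2) / e * e <= `|dp (q k)| * e.
    apply: ler_wpM2r; first exact: ltW.
    by apply: le_trans h5; rewrite lerDl divr_ge0// ltW.
  rewrite mulfVK ?gt_eqF//.
  have := ler_norm (dp w * (w - a)); lra.
(* By [h1], [s k] and [w - q k] have the same sign; multiplying by the square of [w - q k] reduces
   the claim to [dv]. *)
have ds : dp (q k) * s k < 0.
  have v2 : 0 < (w - q k) ^+ 2.
    by rewrite exprn_even_gt0//; apply: contraTneq h1 => ->; rewrite mulr0 ltxx.
  rewrite -(pmulr_rlt0 _ v2).
  have -> : (w - q k) ^+ 2 * (dp (q k) * s k) =
      dp (q k) * (w - q k) * (s k * (w - q k)) by ring.
  by rewrite pmulr_llt0.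
rewrite -[leLHS]opprK -(ltr0_norm ds) normrM lerNl.
apply: le_trans (_ : `|A| <= _); first by rewrite -normrN ler_norm.
apply: le_trans (_ : `|dp (q k)| * f <= _); last by rewrite ler_wpM2l.
rewrite -ler_pdivrMr//.
by apply: le_trans h5; rewrite lerDr divr_ge0// ?addr_ge0// ltW.
Unshelve. all: by end_near. Qed.

End Kernel1D.

(** * The update map in terms of real-valued functions *)

Section Core.
Context {R : realType} {n : nat} (I : set R) (p dp : R -> R).
Context (p_conv : forall x y l : R, I x -> I y -> x != y -> 0 < l < 1 ->
  I (l * x + (1 - l) * y) /\ p (l * x + (1 - l) * y) < l * p x + (1 - l) * p y).
Context (p_der : forall s : R, I° s -> derivable p s 1 /\ 'D_1 p s = dp s).
Context (dp_cont : forall s : R, I° s -> {for s, continuous dp}).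
Context (dp_infty : forall (u : nat -> R) (a : R), (forall k, I° (u k)) ->
  bd I a -> u @ \oo --> a -> `|dp (u k)| @[k --> \oo] --> +oo).
Context (X : set 'rV[R]_n) (ga : 'rV[R]_n -> 'rV[R]_n -> R) (G : 'rV[R]_n -> R).
Context (X_closed : closed X).
Context (X_conv : forall (x y : 'rV[R]_n) (l : R), X x -> X y -> 0 < l < 1 ->
  X (x + l *: (y - x))).
Context (X_clI : forall (x : 'rV[R]_n) i, X x -> closure I (x 0 i)).
Context (ga_der : forall x y d : 'rV[R]_n, X x -> X y -> derivable (ga^~ x) y d).
Context (ga_cvg : forall (z y : nat -> 'rV[R]_n) (a b : 'rV[R]_n),
  (forall k, X (z k)) -> (forall k, X (y k)) -> X a -> X b ->
  z @ \oo --> a -> y @ \oo --> b -> ga (y k) (z k) @[k --> \oo] --> ga b a).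
Context (G_conv : forall (x y : 'rV[R]_n) (l : R), X x -> X y -> 0 < l < 1 ->
  G (x + l *: (y - x)) <= G x + l * (G y - G x)).
Context (G_cvg : forall (y : nat -> 'rV[R]_n) (b : 'rV[R]_n),
  (forall k, X (y k)) -> X b -> y @ \oo --> b -> G (y k) @[k --> \oo] --> G b).

(** [inner] and [feasible] are the coordinatewise forms of [X] intersected with the interior of
    [edom h] and with [edom h]. *)
Definition inner : set 'rV[R]_n := [set x | X x /\ forall i, I° (x 0 i)].
Definition feasible : set 'rV[R]_n := [set x | X x /\ forall i, I (x 0 i)].
Definition breg (y x : 'rV[R]_n) : R :=
  \sum_(i < n) bregman1 p dp (y 0 i) (x 0 i).
Definition model (t : R) (y x : 'rV[R]_n) : R := ga y x + G y + t^-1 * breg y x.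

Lemma segE (x y : 'rV[R]_n) (l : R) i :
  (x + l *: (y - x)) 0 i = x 0 i + l * (y 0 i - x 0 i).
Proof. by rewrite !mxE. Qed.

Lemma inner_feasible (x : 'rV[R]_n) : inner x -> feasible x.
Proof. by move=> [Xx Ix]; split=> // i; apply: interior_subset. Qed.

Lemma inner_seg (y x : 'rV[R]_n) (l : R) : X y -> inner x -> 0 < l < 1 ->
  inner (y + l *: (x - y)).
Proof.
move=> Xy [Xx Ix] l01; split; first exact: X_conv.
by move=> i; rewrite segE; apply: (interior_segment p_conv) => //; exact: X_clI.
Qed.

Lemma breg_ge0 (y x : 'rV[R]_n) : feasible y -> inner x -> 0 <= breg y x.
Proof.
move=> [_ Iy] [_ Ix]; apply: sumr_ge0 => i _.
exact: (bregman1_ge0 p_conv p_der).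
Qed.

Lemma bregman1_le_breg (y x : 'rV[R]_n) i : feasible y -> inner x ->
  bregman1 p dp (y 0 i) (x 0 i) <= breg y x.
Proof.
move=> [_ Iy] [_ Ix]; rewrite /breg (bigD1 i)//= lerDl.
by apply: sumr_ge0 => j _; exact: (bregman1_ge0 p_conv p_der).
Qed.

Lemma breg_xx (x : 'rV[R]_n) : breg x x = 0.
Proof. by rewrite /breg big1// => i _; rewrite /bregman1 !subrr mulr0 subrr. Qed.

Lemma bregman1_cvg (u : nat -> R) (a s : R) : I° a -> u @ \oo --> a ->
  bregman1 p dp (u k) s @[k --> \oo] --> bregman1 p dp a s.
Proof.
move=> Ia ua; have [dpa _] := p_der Ia.
have pa : p (u k) @[k --> \oo] --> p a.
  apply: (cvg_comp _ p ua); apply: (@differentiable_continuous _ R R^o).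
  exact/derivable1_diffP.
apply: cvgB; first by apply: cvgB => //; exact: cvg_cst.
by apply: cvgM; [exact: cvg_cst|apply: cvgB => //; exact: cvg_cst].
Qed.

(* Moving from [y] towards the interior point [x] changes the Bregman term by a
   sum of nonpositive slopes, one of which blows up if [ybar] is not interior. *)
Lemma descent (t : R) (x ybar : 'rV[R]_n) (y : nat -> 'rV[R]_n) : 0 < t ->
  inner x -> (forall k, feasible (y k)) -> y @ \oo --> ybar -> X ybar ->
  ~ inner ybar ->
  exists l : R, 0 < l < 1 /\ \forall k \near \oo,
    model t (y k + l *: (x - y k)) x <= model t (y k) x - l.
Proof.
move=> t0 Sx Fy yy Xyb nS; have [Xx Ix] := Sx.
have [i0 nIi0] : exists i, ~ I° (ybar 0 i).
  by apply: contrapT => H; apply: nS; split=> // i; apply: contrapT => ?; apply: H; exists i.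
have bdi0 : bd I (ybar 0 i0) by split=> //; exact: X_clI.
pose d := x - ybar.
pose l_ (j : nat) : R := j.+2%:R^-1.
have l01 j : 0 < l_ j < 1 := invnatS2_itv R j.
have ln0 j : l_ j != 0 by case/andP: (l01 j) => h _; rewrite gt_eqF.
have l_0 : l_ @ \oo --> (0 : R) := cvg_invnatS2 (R:=R).
pose slope (v : 'rV[R]_n) (l : R) i :=
  (dp (v 0 i + l * (x 0 i - v 0 i)) - dp (x 0 i)) * (x 0 i - v 0 i).
(* [l * q l] is the limit along [y] of an upper bound for the change of the model. The Bregman term
   enters through slopes only, since [ybar] may have coordinates outside [I]. *)
pose q (l : R) := (ga (ybar + l *: d) x - ga ybar x) / l + (G x - G ybar)
    + t^-1 * \sum_(i < n) slope ybar l i.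
have Ipos j i : I° (ybar 0 i + l_ j * (x 0 i - ybar 0 i)).
  by apply: (interior_segment p_conv) => //; exact: X_clI.
have slope_le0 j i : slope ybar (l_ j) i <= 0.
  have := dp_mono p_conv p_der (Ix i) (Ipos j i).
  have -> : x 0 i - (ybar 0 i + l_ j * (x 0 i - ybar 0 i)) =
      (1 - l_ j) * (x 0 i - ybar 0 i) by ring.
  rewrite mulrCA pmulr_rge0; last by case/andP: (l01 j); rewrite subr_gt0.
  rewrite /slope; lra.
have slope_oo : slope ybar (l_ j) i0 @[j --> \oo] --> -oo.
  have H : dp (ybar 0 i0 + l_ j * (x 0 i0 - ybar 0 i0)) * (x 0 i0 - ybar 0 i0)
      @[j --> \oo] --> -oo.
    apply: (dp_blowup p_conv p_der dp_infty bdi0 (Ix i0)) (cvg_cst _) _ => //.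
      exact: (@cvg_seg_param R R^o (ybar 0 i0) (x 0 i0) l_ l_0).
    rewrite -expr2 exprn_even_gt0//= subr_eq0; apply/eqP => E.
    by apply: nIi0; rewrite -E.
  apply/cvgrNyPle => A.
  near=> j; rewrite /slope mulrBl lerBlDr.
  by near: j; exact: cvgrNy_le H _.
(* The quotient of [ga] has a finite limit, all slopes are nonpositive, and the one at [i0] tends to
   [-oo]. *)
have [j qj] : exists j, q (l_ j) < -1.
  have gq := derive_cvg_seq (ga_der (d := d) Xx Xyb) l_0 ln0.
  set D := 'D_d _ _ in gq.
  have : \forall j \near \oo, q (l_ j) < -1.
    near=> j.
    have h1 : (ga (ybar + l_ j *: d) x - ga ybar x) / l_ j < D + 1.
      by near: j; apply: cvgr_lt gq _ _; rewrite ltrDl.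
    (* The threshold makes the three parts of [q] add up to less than -1. *)
    have h2 : slope ybar (l_ j) i0 <= - t * (D + 2 + (G x - G ybar)).
      by near: j; exact: cvgrNy_le slope_oo _.
    have h3 : \sum_(i < n) slope ybar (l_ j) i <= - t * (D + 2 + (G x - G ybar)).
      apply: le_trans h2; rewrite (bigD1 i0)//= gerDl; exact: sumr_le0.
    have h4 : t^-1 * \sum_(i < n) slope ybar (l_ j) i <= - (D + 2 + (G x - G ybar)).
      by rewrite ler_pdivrMl// mulrN -mulNr.
    rewrite /q; lra.
  by move=> /filter_ex.
exists (l_ j); split; first exact: l01.
move: (l_ j) (l01 j) qj (Ipos j) => l {}l01 ql {}Ipos.
have [lgt0 llt1] := andP l01.
(* By convexity of [G] and [bregman1_diff], [E k] bounds the change of the model at [y k]; it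
   converges because the segment from [ybar] is interior at [l]. *)
pose E k := ga (y k + l *: (x - y k)) x - ga (y k) x + l * (G x - G (y k))
  + t^-1 * (l * \sum_(i < n) slope (y k) l i).
have Xw k : X (y k + l *: (x - y k)) by apply: X_conv => //; case: (Fy k).
have wcvg : y k + l *: (x - y k) @[k --> \oo] --> ybar + l *: d.
  by apply: cvg_seg => //; exact: cvg_cst.
have Ecvg : E k @[k --> \oo] --> l * q l.
  have -> : l * q l = ga (ybar + l *: d) x - ga ybar x + l * (G x - G ybar)
      + t^-1 * (l * \sum_(i < n) slope ybar l i).
    by rewrite /q !mulrDr mulrCA divff ?gt_eqF// mulr1; congr (_ + _); rewrite mulrCA.
  apply: cvgD; [apply: cvgD|].
  - apply: cvgB; apply: (ga_cvg (z := fun=> x)) => //; try exact: cvg_cst.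
      exact: X_conv.
    by move=> k; case: (Fy k).
  - apply: cvgM; first exact: cvg_cst.
    apply: cvgB; first exact: cvg_cst.
    by apply: G_cvg => // k; case: (Fy k).
  - apply: cvgM; first exact: cvg_cst.
    apply: cvgM; first exact: cvg_cst.
    apply: cvg_sum_seq => i; have yi := cvg_coord (i := i) yy.
    apply: cvgM; last by apply: cvgB => //; exact: cvg_cst.
    apply: cvgB; last exact: cvg_cst.
    apply: (dp_cvg dp_cont (Ipos i)).
    exact: (@cvg_seg R R^o _ _ _ _ l yi (cvg_cst (x 0 i))).
have lq : l * q l < - l by rewrite -[ltRHS]mulrN1 ltr_pM2l.
near=> k.
have Ek : E k <= - l by near: k; apply: cvgr_le Ecvg _ _.
have [Xy Iy] := Fy k.
have Sw : inner (y k + l *: (x - y k)) by exact: inner_seg.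
have Db : breg (y k + l *: (x - y k)) x - breg (y k) x <= l * \sum_(i < n) slope (y k) l i.
  rewrite /breg -sumrB mulr_sumr; apply: ler_sum => i _; rewrite segE.
  have Iw : I° (y k 0 i + l * (x 0 i - y k 0 i)) by case: Sw => _ /(_ i); rewrite segE.
  apply: le_trans (bregman1_diff p_conv p_der (Iy i) Iw (Ix i)) _.
  by rewrite [_ + _ - y k 0 i]addrAC subrr add0r mulrCA.
have tD : t^-1 * (breg (y k + l *: (x - y k)) x - breg (y k) x) <=
    t^-1 * (l * \sum_(i < n) slope (y k) l i) by rewrite ler_pM2l// invr_gt0.
have Gw := G_conv Xy Xx l01.
rewrite /model; rewrite /E in Ek; lra.
Unshelve. all: by end_near. Qed.

(** * Existence and interiority of the minimizer *)

Context (tbar t : R) (t0 : 0 < t) (ttbar : t < tbar).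
Context (coercive : forall (z y : nat -> 'rV[R]_n) (a : 'rV[R]_n) (K : R),
  (forall k, inner (z k)) -> (forall k, inner (y k)) -> X a -> z @ \oo --> a ->
  (forall k, model t (y k) (z k) <= K) ->
  exists (s : nat -> nat) (b : 'rV[R]_n),
    (forall k, (k <= s k)%N) /\ y (s k) @[k --> \oo] --> b).

Lemma cvg_in_X (y : nat -> 'rV[R]_n) (b : 'rV[R]_n) :
  (forall k, X (y k)) -> y @ \oo --> b -> X b.
Proof. by move=> Xy yb; apply: (closed_cvg X X_closed _ _ yb); exact: nearW. Qed.

Lemma ga_G_le_model (y x : 'rV[R]_n) : feasible y -> inner x ->
  ga y x + G y <= model t y x.
Proof. by move=> Fy Sx; rewrite lerDl mulr_ge0 ?breg_ge0// invr_ge0 ltW. Qed.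

(** Inner points with values tending to [-oo] would, by coercivity, have a subsequence converging in
    [X], along which the lower bound [ga + G] converges. *)
Lemma model_lower_bound (x : 'rV[R]_n) : inner x ->
  exists m, forall y, inner y -> m <= model t y x.
Proof.
move=> Sx; apply: contrapT => nm.
have /choice[y yP] : forall k : nat, exists y, inner y /\ model t y x < - k%:R.
  move=> k; apply: contrapT => ny; apply: nm; exists (- k%:R) => y Sy.
  by rewrite leNgt; apply/negP => ?; apply: ny; exists y.
have Sy k : inner (y k) by case: (yP k).
have [|||||s [b [sk yb]]] := @coercive (fun=> x) y x 0 => //.
- by case: Sx.
- exact: cvg_cst.
- by move=> k; case: (yP k) => _ /ltW /le_trans -> //; rewrite oppr_le0.
have Xb : X b by apply: (cvg_in_X _ yb) => k; case: (Sy (s k)).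
have gb : ga (y (s k)) x + G (y (s k)) @[k --> \oo] --> ga b x + G b.
  have Xys k : X (y (s k)) by case: (Sy (s k)).
  apply: cvgD; last exact: G_cvg.
  by apply: (ga_cvg (z := fun=> x)) => //; [case: Sx|case: Sx|exact: cvg_cst].
have : \forall k \near \oo, False.
  near=> k.
  have h1 : ga b x + G b - 1 <= ga (y (s k)) x + G (y (s k)).
    by near: k; apply: cvgr_ge gb _ _; rewrite ltrBlDr ltrDl.
  have h2 := ga_G_le_model (inner_feasible (Sy (s k))) Sx.
  have [_ h3] := yP (s k).
  have h4 : `|ga b x + G b - 1| <= k%:R by near: k; exact: nbhs_infty_ger.
  have h5 : k%:R <= (s k)%:R :> R by rewrite ler_nat.
  move: h4; rewrite ler_norml => /andP[h4 _].
  lra.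
by move=> /filter_ex [].
Unshelve. all: by end_near. Qed.

(** If [y] were not inner, [descent] for the constant sequence [y] would produce a strictly better
    inner point. *)
Lemma feasible_minimizer_inner (x y : 'rV[R]_n) : inner x -> feasible y ->
  (forall u, feasible u -> model t y x <= model t u x) -> inner y.
Proof.
move=> Sx Fy ymin; apply: contrapT => nSy.
have [Xy _] := Fy.
have [l [l01 H]] := @descent t x y (fun=> y) t0 Sx (fun=> Fy) (cvg_cst y) Xy nSy.
have [k] := filter_ex H.
have /ymin := inner_feasible (inner_seg Xy Sx l01).
by case/andP: l01 => l0 _; lra.
Qed.

(** The kernel may be discontinuous at the boundary, so continuity at [u] is replaced by convexity:
    on the segment towards [x] it bounds the inner values by quantities tending to [model t u x]. *)
Lemma inner_minimizer_feasible (x y : 'rV[R]_n) : inner x ->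
  (forall u, inner u -> model t y x <= model t u x) ->
  forall u, feasible u -> model t y x <= model t u x.
Proof.
move=> Sx ymin u [Xu Iu]; have [Xx Ix] := Sx.
pose l_ (j : nat) : R := j.+2%:R^-1.
have l01 j : 0 < l_ j < 1 := invnatS2_itv R j.
have l_0 : l_ @ \oo --> (0 : R) := cvg_invnatS2 (R:=R).
have gal : ga (u + l_ k *: (x - u)) x @[k --> \oo] --> ga u x.
  apply: (ga_cvg (z := fun=> x)) => //.
  - by move=> k; exact: X_conv.
  - exact: cvg_cst.
  - exact: cvg_seg_param.
have lin c d : d + l_ k * (c - d) @[k --> \oo] --> d.
  exact: (@cvg_seg_param R R^o d c l_ l_0).
have H : (ga (u + l_ k *: (x - u)) x + (G u + l_ k * (G x - G u))
    + t^-1 * (breg u x + l_ k * (breg x x - breg u x))) @[k --> \oo] --> model t u x.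
  by apply: cvgD; [apply: cvgD|apply: cvgM => //; exact: cvg_cst].
apply: (ler_cvg_seq (cvg_cst _) H) => k /=.
apply: le_trans (ymin _ (inner_seg Xu Sx (l01 k))) _.
have tV : 0 < t^-1 by rewrite invr_gt0.
rewrite /model; apply: lerD; first by rewrite lerD2l; exact: G_conv.
rewrite ler_pM2l// /breg -sumrB mulr_sumr -big_split; apply: ler_sum => i _ /=.
have := kernel_convex p_conv (interior_subset (Ix i)) (Iu i) (l01 k).
have -> : l_ k * x 0 i + (1 - l_ k) * u 0 i = u 0 i + l_ k * (x 0 i - u 0 i) by ring.
by rewrite segE /bregman1; lra.
Qed.

(** A minimizing sequence of inner points has a limit point [b]. An inner [b] is a minimizer by
    continuity; otherwise [descent] lowers the values by a fixed [l], eventually below the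
    infimum. *)
Lemma exists_minimizer (x : 'rV[R]_n) : inner x ->
  exists y, inner y /\ forall u, feasible u -> model t y x <= model t u x.
Proof.
move=> Sx; have [Xx Ix] := Sx.
pose A := [set model t y x | y in inner].
have infA : has_inf A.
  split; first by exists (model t x x); exists x.
  have [m mP] := model_lower_bound Sx.
  by exists m => _ [y Sy <-]; exact: mP.
have Amin y : inner y -> inf A <= model t y x.
  by move=> Sy; apply: ge_inf; [case: infA|exists y].
have /choice[y yP] : forall k : nat, exists y, inner y /\ model t y x < inf A + k.+2%:R^-1.
  move=> k; have /andP[k0 _] := invnatS2_itv R k.
  by have [_ [y Sy <-] ylt] := inf_adherent k0 infA; exists y.
have Sy k : inner (y k) by case: (yP k).
have [|||||s [b [sk yb]]] := @coercive (fun=> x) y x (inf A + 1) => //.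
- exact: cvg_cst.
- move=> k; case: (yP k) => _ /ltW /le_trans -> //; rewrite lerD2l.
  by case/andP: (invnatS2_itv R k) => _ /ltW.
have Xb : X b by apply: (cvg_in_X _ yb) => k; case: (Sy (s k)).
have inv0 := cvg_subseq sk (@cvg_invnatS2 R).
have [Sb|nSb] := pselect (inner b).
  exists b; split=> //; apply: inner_minimizer_feasible => // u Su.
  apply: le_trans (Amin u Su).
  have mb : model t (y (s k)) x @[k --> \oo] --> model t b x.
    apply: cvgD; first apply: cvgD.
    - apply: (ga_cvg (z := fun=> x)) => //; last exact: cvg_cst.
      by move=> k; case: (Sy (s k)).
    - by apply: G_cvg => // k; case: (Sy (s k)).
    - apply: cvgM; first exact: cvg_cst.
      apply: cvg_sum_seq => i; apply: bregman1_cvg; first by case: Sb.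
      exact: cvg_coord.
  have H : (inf A + (s k).+2%:R^-1) @[k --> \oo] --> inf A.
    by rewrite -[X in _ --> X]addr0; apply: cvgD => //; exact: cvg_cst.
  by apply: (ler_cvg_seq mb H) => k /=; apply: ltW; case: (yP (s k)).
have [l [l01 H]] := @descent t x b (y \o s) t0 Sx (fun k => inner_feasible (Sy (s k))) yb Xb nSb.
have l0 : 0 < l by case/andP: l01.
have : \forall k \near \oo, False.
  near=> k.
  have h1 : model t (y (s k) + l *: (x - y (s k))) x <= model t (y (s k)) x - l.
    by near: k.
  have h2 : (s k).+2%:R^-1 < l by near: k; exact: cvgr_lt inv0 _ l0.
  have [Xyk _] := Sy (s k).
  have h3 := Amin _ (inner_seg Xyk Sx l01).
  have [_ h4] := yP (s k); move: h2 h4; set r := _.+2%:R^-1 => h2 h4.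
  lra.
by move=> /filter_ex [].
Unshelve. all: by end_near. Qed.

(** * Limit points of the update *)

Context (T : 'rV[R]_n -> 'rV[R]_n).
Context (T_inner : forall x, inner x -> inner (T x)).
Context (T_min : forall x u, inner x -> feasible u -> model t (T x) x <= model t u x).

(** Comparison with [z k] itself bounds the model values. Coercivity then gives the limit, and the
    resulting bound on the Bregman term forbids a boundary coordinate to move. *)
Lemma update_subseq (z : nat -> 'rV[R]_n) (zbar : 'rV[R]_n) :
  (forall k, inner (z k)) -> X zbar -> z @ \oo --> zbar ->
  exists (s : nat -> nat) (b : 'rV[R]_n), [/\ forall k, (k <= s k)%N, X b,
    T (z (s k)) @[k --> \oo] --> b &
    forall i, bd I (zbar 0 i) -> b 0 i = zbar 0 i].
Proof.
move=> Sz Xz zz.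
have Xzk k : X (z k) by case: (Sz k).
have gz : ga (z k) (z k) + G (z k) @[k --> \oo] --> ga zbar zbar + G zbar.
  by apply: cvgD; [exact: ga_cvg|exact: G_cvg].
have [K KP] : exists K, forall k, ga (z k) (z k) + G (z k) <= K.
  have /cvg_seq_bounded/pinfty_ex_gt0[K _ /= KP] : cvgn (fun k => ga (z k) (z k) + G (z k)).
    by apply/cvg_ex; exists (ga zbar zbar + G zbar); exact: gz.
  by exists K => k; apply: le_trans (ler_norm _) (KP k _).
have mK k : model t (T (z k)) (z k) <= K.
  apply: le_trans (T_min (Sz k) (inner_feasible (Sz k))) _.
  by rewrite /model breg_xx mulr0 addr0.
have [s [b [sk yb]]] := coercive Sz (fun k => T_inner (Sz k)) Xz zz mK.
have Xy k : X (T (z (s k))) by case: (T_inner (Sz (s k))).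
have Xb : X b by apply: cvg_in_X yb.
have zs := cvg_subseq sk zz.
exists s, b; split=> // i bdi; apply: contrapT => bi.
have clb : closure I (b 0 i) by exact: X_clI.
have clz : closure I (zbar 0 i) by exact: X_clI.
(* The midpoint is interior and separates [b 0 i] from [zbar 0 i]: this is the sign condition of
   [dp_blowup]. *)
pose w := (b 0 i + zbar 0 i) / 2.
have Iw : I° w.
  have [lt|lt|//] := ltgtP (b 0 i) (zbar 0 i).
  - by apply: (closure_between (dom_convex p_conv) clb clz); rewrite !midf_lt.
  - by apply: (closure_between (dom_convex p_conv) clz clb); rewrite /w addrC !midf_lt.
have yi := cvg_coord (i := i) yb.
have zi := cvg_coord (i := i) zs.
have ywi : T (z (s k)) 0 i - w @[k --> \oo] --> b 0 i - w.
  by apply: cvgB => //; exact: cvg_cst.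
have pos : 0 < (b 0 i - w) * (w - zbar 0 i).
  have -> : (b 0 i - w) * (w - zbar 0 i) = ((b 0 i - zbar 0 i) / 2) ^+ 2.
    by rewrite /w; field.
  rewrite exprn_even_gt0//= mulf_neq0// subr_eq0; exact/eqP.
have blow : dp (z (s k) 0 i) * (T (z (s k)) 0 i - w) @[k --> \oo] --> -oo.
  apply: (dp_blowup p_conv p_der dp_infty bdi Iw) ywi pos => //.
  by move=> k; case: (Sz (s k)).
have gy : ga (T (z (s k))) (z (s k)) + G (T (z (s k))) @[k --> \oo] --> ga b zbar + G b.
  by apply: cvgD; [exact: ga_cvg|exact: G_cvg].
have dwy : dp w * (T (z (s k)) 0 i - w) @[k --> \oo] --> dp w * (b 0 i - w).
  by apply: cvgM => //; exact: cvg_cst.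
have : \forall k \near \oo, False.
  near=> k.
  have h1 : ga b zbar + G b - 1 <= ga (T (z (s k))) (z (s k)) + G (T (z (s k))).
    by near: k; apply: cvgr_ge gy _ _; rewrite ltrBlDr ltrDl.
  have h2 : dp w * (b 0 i - w) - 1 <= dp w * (T (z (s k)) 0 i - w).
    by near: k; apply: cvgr_ge dwy _ _; rewrite ltrBlDr ltrDl.
  (* The constants contradict the three-point inequality by a margin of 1: [h2] costs 1, and [h4]
     bounds the divergence by [t] times the last bracket. *)
  have h3 : dp (z (s k) 0 i) * (T (z (s k)) 0 i - w) <=
      dp w * (b 0 i - w) - 2 - t * (K - (ga b zbar + G b) + 1).
    by near: k; exact: cvgrNy_le blow _.
  have Sy := T_inner (Sz (s k)).
  have h4 : t^-1 * breg (T (z (s k))) (z (s k)) <= K - (ga b zbar + G b) + 1.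
    by have := mK (s k); rewrite /model; lra.
  rewrite ler_pdivrMl// in h4.
  have h5 := bregman1_le_breg i (inner_feasible Sy) (Sz (s k)).
  have := three_point p_conv p_der ((inner_feasible Sy).2 i) Iw ((Sz (s k)).2 i).
  rewrite mulrBl; lra.
by move=> /filter_ex [].
Unshelve. all: by end_near. Qed.

(** The function of [surrogate_strictly_convex], in real values. *)
Definition kernel_model (x u : 'rV[R]_n) : R :=
  tbar * (ga u x + G u) + \sum_(i < n) p (u 0 i).
Context (kernel_model_conv : forall (x y z : 'rV[R]_n) (l : R),
  X x -> inner y -> inner z -> 0 < l < 1 ->
  kernel_model x (z + l *: (y - z)) <=
    kernel_model x z + l * (kernel_model x y - kernel_model x z)).

(* Convexity of the model with the larger step [tbar] leaves a surplus
   [t^-1 - tbar^-1] of Bregman divergence. *)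
Lemma update_breg_bound (z : 'rV[R]_n) (l : R) : inner z -> 0 < l < 1 ->
  let w := z + l *: (T z - z) in
  l * (t^-1 - tbar^-1) * breg (T z) z <= ga z z + G z - (ga w z + G w).
Proof.
move=> Sz l01; set w := z + l *: (T z - z); rewrite /=.
have Sy := T_inner Sz; have [Xz Iz] := Sz; have [Xy Iy] := Sy.
have Sw : inner w by exact: inner_seg.
have := kernel_model_conv Xz Sy Sz l01; rewrite /kernel_model -/w.
set Py := ga (T z) z + G (T z); set Pz := ga z z + G z; set Pw := ga w z + G w.
(* [breg u z] differs from the sum of [p] by an affine function of [u], so convexity carries over to
   [tbar * (ga + G) + breg]. *)
have bregE u : breg u z = \sum_(i < n) p (u 0 i) - \sum_(i < n) p (z 0 i)
    - \sum_(i < n) dp (z 0 i) * (u 0 i - z 0 i) by rewrite /breg !sumrB.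
have linw : \sum_(i < n) dp (z 0 i) * (w 0 i - z 0 i) =
    l * \sum_(i < n) dp (z 0 i) * (T z 0 i - z 0 i).
  by rewrite mulr_sumr; apply: eq_bigr => i _; rewrite segE; ring.
(* Dropping the divergence at [w] leaves a bound on [ga + G] alone. *)
have Dw := breg_ge0 (inner_feasible Sw) Sz.
have := bregE w; have := bregE (T z); rewrite linw.
have := T_min Sz (inner_feasible Sz); rewrite /model breg_xx mulr0 addr0 -/Py -/Pz.
set D := breg (T z) z; set D' := breg w z.
move: Dw; rewrite -/D'.
move: D' => D'; move: D => D.
set sz := \sum_(i < n) p (z 0 i); set sw := \sum_(i < n) p (w 0 i).
set sy := \sum_(i < n) p (T z 0 i); set ln := \sum_(i < n) _.
move=> D'0 ymin ED ED' conv.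
have tbar0 : 0 < tbar by apply: lt_trans ttbar.
have [l0 l1] := andP l01.
have conv' : tbar * Pw <= tbar * Pz + l * (tbar * Py - tbar * Pz + D).
  by move: conv; rewrite ED; lra.
have {}conv' : Pw <= Pz + l * (Py - Pz + tbar^-1 * D).
  rewrite -(ler_pM2l tbar0); apply: le_trans conv' _.
  by rewrite -[in leLHS](mulVKf (lt0r_neq0 tbar0) D); lra.
(* Minimality of [T z] against [z] reads [Py + t^-1 * D <= Pz]. *)
have : l * (Py - Pz + tbar^-1 * D) <= l * (- (t^-1 * D) + tbar^-1 * D).
  by rewrite ler_pM2l// lerD2r; lra.
lra.
Qed.

(** * Vanishing residuals and stationarity on the face of [zbar] *)

Context (zbar : 'rV[R]_n) (Xz : X zbar) (w0 : 'rV[R]_n).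
Context (ga_grad : forall d : 'rV[R]_n, 'D_d (ga^~ zbar) zbar = dot w0 d).

(** The part of the manifold of [zbar] on which [g] is finite. *)
Definition face : set 'rV[R]_n :=
  [set u | X u /\ forall i, bd I (zbar 0 i) -> u 0 i = zbar 0 i].

Lemma face_stationary_breg_cvg0 :
  (forall u, face u -> 0 <= dot w0 (u - zbar) + G u - G zbar) ->
  forall z : nat -> 'rV[R]_n, (forall k, inner (z k)) -> z @ \oo --> zbar ->
  breg (T (z k)) (z k) @[k --> \oo] --> (0 : R).
Proof.
move=> stat z Sz zz; apply/cvgrPdist_lt => e e0; apply: contrapT => nlt.
have [|r [rk re]] := @frequently_subseq (fun k => e <= breg (T (z k)) (z k)).
  move=> H; apply: nlt; apply: filterS H => k /negP; rewrite -ltNge => H.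
  rewrite sub0r normrN ger0_norm//; apply: breg_ge0 => //.
  by apply: inner_feasible; exact: T_inner.
have zr := cvg_subseq rk zz.
have [s [b [sk Xb yb bB]]] := update_subseq (fun k => Sz (r k)) Xz zr.
have zrs := cvg_subseq sk zr.
have Xzk k : X (z (r (s k))) by case: (Sz (r (s k))).
have Xyk k : X (T (z (r (s k)))) by case: (T_inner (Sz (r (s k)))).
have c0 : 0 < t^-1 - tbar^-1 by rewrite subr_gt0 ltf_pV2// posrE (lt_trans t0).
pose l_ (j : nat) : R := j.+2%:R^-1.
have l01 j : 0 < l_ j < 1 := invnatS2_itv R j.
have ln0 j : l_ j != 0 by case/andP: (l01 j) => h _; rewrite gt_eqF.
have l_0 : l_ @ \oo --> (0 : R) := cvg_invnatS2 (R:=R).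
pose d := b - zbar.
(* The limit in [k] is taken first, at the fixed step [l_ j]; [ga] is differentiated only
   afterwards. *)
have bound j : (t^-1 - tbar^-1) * e <=
    - ((ga (zbar + l_ j *: d) zbar - ga zbar zbar) / l_ j) + dot w0 d.
  have [lj0 _] := andP (l01 j).
  pose w k := z (r (s k)) + l_ j *: (T (z (r (s k))) - z (r (s k))).
  have Xw k : X (w k) by apply: X_conv.
  have Xwb : X (zbar + l_ j *: d) by exact: X_conv.
  have ww : w @ \oo --> zbar + l_ j *: d by apply: cvg_seg.
  have lim : ga (z (r (s k))) (z (r (s k))) + G (z (r (s k))) - (ga (w k) (z (r (s k))) + G (w k))
      @[k --> \oo] --> ga zbar zbar + G zbar - (ga (zbar + l_ j *: d) zbar + G (zbar + l_ j *: d)).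
    by apply: cvgB; (apply: cvgD; [exact: ga_cvg|exact: G_cvg]).
  have : l_ j * (t^-1 - tbar^-1) * e <=
      ga zbar zbar + G zbar - (ga (zbar + l_ j *: d) zbar + G (zbar + l_ j *: d)).
    apply: (ler_cvg_seq (cvg_cst _) lim) => k /=.
    apply: le_trans (update_breg_bound (Sz (r (s k))) (l01 j)).
    by rewrite ler_pM2l// mulr_gt0.
  have dl : dot w0 (zbar + l_ j *: d - zbar) = l_ j * dot w0 d.
    by rewrite /dot mulr_sumr; apply: eq_bigr => i _; rewrite !mxE; ring.
  have fw : face (zbar + l_ j *: d).
    by split=> // i /bB bi; rewrite segE bi subrr mulr0 addr0.
  (* Stationarity at the segment point itself bounds the variation of [G], which need not be
     differentiable. *)
  have := stat _ fw; rewrite dl => h1 h2.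
  rewrite -(ler_pM2l lj0) mulrDr mulrN (mulrC (l_ j) (_ / _)) mulfVK//; lra.
have : (t^-1 - tbar^-1) * e <= 0.
  have dg := derive_cvg_seq (ga_der (d := d) Xz Xz) l_0 ln0; rewrite ga_grad in dg.
  (* As [l_ j] tends to 0 the two directional terms cancel. *)
  rewrite -[X in _ <= X](addNr (dot w0 d)).
  by apply: (ler_cvg_seq (cvg_cst _) (cvgD (cvgN dg) (cvg_cst _)) bound).
by rewrite pmulr_rle0// leNgt e0.
Qed.

Lemma breg_cvg0_face_stationary (x0 : 'rV[R]_n) : inner x0 ->
  (forall z : nat -> 'rV[R]_n, (forall k, inner (z k)) -> z @ \oo --> zbar ->
    breg (T (z k)) (z k) @[k --> \oo] --> (0 : R)) ->
  forall u, face u -> 0 <= dot w0 (u - zbar) + G u - G zbar.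
Proof.
move=> Sx0 stop u [Xu uB]; have [Xx0 Ix0] := Sx0.
pose l_ (j : nat) : R := j.+2%:R^-1.
have l01 j : 0 < l_ j < 1 := invnatS2_itv R j.
have ln0 j : l_ j != 0 by case/andP: (l01 j) => h _; rewrite gt_eqF.
have l_0 : l_ @ \oo --> (0 : R) := cvg_invnatS2 (R:=R).
pose z k := zbar + l_ k *: (x0 - zbar).
pose v k := u + l_ k *: (x0 - u).
have Sz k : inner (z k) by exact: inner_seg.
have Sv k : inner (v k) by exact: inner_seg.
have zz : z @ \oo --> zbar by exact: cvg_seg_param.
have vu : v @ \oo --> u by exact: cvg_seg_param.
have Dz := stop z Sz zz.
have [s [b [sk Xb yb bB]]] := update_subseq Sz Xz zz.
have zs := cvg_subseq sk zz; have vs := cvg_subseq sk vu.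
have Ds := cvg_subseq sk Dz.
have Sy k : inner (T (z (s k))) by exact: T_inner.
have Iz i : ~ bd I (zbar 0 i) -> I° (zbar 0 i).
  by move=> nb; apply: contrapT => nI; apply: nb; split=> //; exact: X_clI.
(* At an interior coordinate, a limit [b 0 i] other than [zbar 0 i] would, by the three-point
   inequality at their midpoint [w], keep the residuals above a quantity with positive limit. *)
have bz : b = zbar.
  apply/rowP => i; have [/bB//|/Iz Izi] := pselect (bd I (zbar 0 i)).
  apply: contrapT => bi.
  have clb : closure I (b 0 i) by exact: X_clI.
  pose w := b 0 i + 2^-1 * (zbar 0 i - b 0 i).
  have h01 : 0 < (2^-1 : R) < 1 by rewrite invr_gt0 ltr0n invf_lt1 ?ltr1n.
  have Iw : I° w by exact: (interior_segment p_conv).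
  have yi := cvg_coord (i := i) yb.
  have zi := cvg_coord (i := i) zs.
  have lim : (dp w - dp (z (s k) 0 i)) * (T (z (s k)) 0 i - w) @[k --> \oo] -->
     (dp w - dp (zbar 0 i)) * (b 0 i - w).
    apply: cvgM; last by apply: cvgB => //; exact: cvg_cst.
    by apply: cvgB; [exact: cvg_cst|exact: (dp_cvg dp_cont Izi)].
  have : (dp w - dp (zbar 0 i)) * (b 0 i - w) <= 0.
    apply: (ler_cvg_seq lim Ds) => k.
    apply: le_trans (bregman1_le_breg i (inner_feasible (Sy k)) (Sz (s k))).
    apply: (three_point p_conv p_der) => //; last by case: (Sz (s k)).
    by case: (inner_feasible (Sy k)).
  apply/negP; rewrite -ltNge.
  have wz : w != zbar 0 i.
    by apply: contra_not_neq bi; rewrite /w; lra.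
  have := dp_strict_mono p_conv p_der Iw Izi wz.
  by congr (_ < _ * _); rewrite /w; field.
subst b.
(* Boundary coordinates contribute a nonpositive amount, bounded here by 0, so limits of [dp] are
   taken at interior coordinates only. *)
pose slope l i := if `[< bd I (zbar 0 i) >] then 0 else
  (dp (zbar 0 i + l * (u 0 i - zbar 0 i)) - dp (zbar 0 i)) * (u 0 i - zbar 0 i).
have bound j : - ((ga (zbar + l_ j *: (u - zbar)) zbar - ga zbar zbar) / l_ j) +
    (G zbar - G u) <= t^-1 * \sum_(i < n) slope (l_ j) i.
  move: (l_ j) (l01 j) => l {}l01; have [l0 l1] := andP l01.
  pose y k := T (z (s k)).
  pose w k := y k + l *: (v (s k) - y k).
  have Sw k : inner (w k) by apply: inner_seg => //; case: (Sy k).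
  have Iwl i : ~ bd I (zbar 0 i) -> I° (zbar 0 i + l * (u 0 i - zbar 0 i)).
    move=> /Iz Izi.
    (* Read from [u], the point moves towards the interior point [zbar 0 i], as [interior_segment]
       requires. *)
    have -> : zbar 0 i + l * (u 0 i - zbar 0 i) = u 0 i + (1 - l) * (zbar 0 i - u 0 i) by ring.
    by apply: (interior_segment p_conv) => //; [exact: X_clI|lra].
  have ww : w @ \oo --> zbar + l *: (u - zbar) by apply: cvg_seg.
  pose slopek k i := if `[< bd I (zbar 0 i) >] then 0 else
    (dp (w k 0 i) - dp (z (s k) 0 i)) * (v (s k) 0 i - y k 0 i).
  have L : ga (y k) (z (s k)) - ga (w k) (z (s k)) + l * (G (y k) - G (v (s k)))
     @[k --> \oo] --> ga zbar zbar - ga (zbar + l *: (u - zbar)) zbar + l * (G zbar - G u).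
    have Xzs k : X (z (s k)) by case: (Sz (s k)).
    have Xys k : X (y k) by case: (Sy k).
    have Xws k : X (w k) by case: (Sw k).
    have Xvs k : X (v (s k)) by case: (Sv (s k)).
    apply: cvgD.
      by apply: cvgB; apply: ga_cvg => //; exact: X_conv.
    apply: cvgM; first exact: cvg_cst.
    by apply: cvgB; exact: G_cvg.
  have Rc : t^-1 * (l * \sum_(i < n) slopek k i) @[k --> \oo] -->
      t^-1 * (l * \sum_(i < n) slope l i).
    apply: cvgM; first exact: cvg_cst.
    apply: cvgM; first exact: cvg_cst.
    apply: cvg_sum_seq => i; rewrite /slopek /slope.
    case: asboolP => [_|nb]; first exact: cvg_cst.
    apply: cvgM; last by apply: cvgB; exact: cvg_coord.
    apply: cvgB; last by apply: (dp_cvg dp_cont (Iz i nb)); exact: cvg_coord.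
    apply: (dp_cvg dp_cont (Iwl i nb)).
    by rewrite -segE; exact: cvg_coord.
  have : ga zbar zbar - ga (zbar + l *: (u - zbar)) zbar + l * (G zbar - G u) <=
      t^-1 * (l * \sum_(i < n) slope l i).
    apply: (ler_cvg_seq L Rc) => k /=.
    have := T_min (Sz (s k)) (inner_feasible (Sw k)); rewrite /model -/(y k) => h1.
    have [Xyk _] := Sy k; have [Xvk _] := Sv (s k).
    have h2 := G_conv Xyk Xvk l01; rewrite -/(y k) -/(w k) in h2.
    have h3 : breg (w k) (z (s k)) - breg (y k) (z (s k)) <= l * \sum_(i < n) slopek k i.
      rewrite /breg -sumrB mulr_sumr; apply: ler_sum => i _.
      have [_ Iyk] := Sy k; have [_ Iwk] := Sw k; have [_ Izk] := Sz (s k).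
      have := bregman1_diff p_conv p_der (interior_subset (Iyk i)) (Iwk i) (Izk i).
      move=> /le_trans; apply; rewrite -/(y k).
      have wy : w k 0 i - y k 0 i = l * (v (s k) 0 i - y k 0 i) by rewrite segE; ring.
      rewrite wy mulrCA ler_pM2l// /slopek; case: asboolP => // bdi.
      (* As [v] and [z] share this coordinate, [w - z] is a positive multiple of [y - z], and
         monotonicity of [dp] makes the term nonpositive. *)
      have vz : v (s k) 0 i = z (s k) 0 i by rewrite !segE uB.
      have := dp_mono p_conv p_der (Iwk i) (Izk i).
      have -> : w k 0 i - z (s k) 0 i = (1 - l) * (y k 0 i - z (s k) 0 i).
        by rewrite segE vz; ring.
      rewrite mulrCA pmulr_rge0 ?subr_gt0// vz; lra.
    have h4 : t^-1 * (breg (w k) (z (s k)) - breg (y k) (z (s k))) <=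
        t^-1 * (l * \sum_(i < n) slopek k i) by rewrite ler_pM2l// invr_gt0.
    lra.
  move=> h; rewrite -(ler_pM2l l0) [leLHS]mulrDr [l * - _]mulrN [l * (_ / _)]mulrC.
  by rewrite mulfVK ?gt_eqF//; lra.
have dg := derive_cvg_seq (ga_der (d := u - zbar) Xz Xz) l_0 ln0; rewrite ga_grad in dg.
(* Continuity of [dp] at the interior coordinates of [zbar] makes the Bregman term of smaller order
   than the step. *)
have sl0 : t^-1 * \sum_(i < n) slope (l_ j) i @[j --> \oo] --> (0 : R).
  rewrite -[X in _ --> X](mulr0 t^-1); apply: cvgM; first exact: cvg_cst.
  have S0 : \sum_(i < n) (0 : R) = 0 by rewrite big1.
  rewrite -[X in _ --> X]S0.
  apply: cvg_sum_seq => i; rewrite /slope; case: asboolP => [_|/Iz Izi]; first exact: cvg_cst.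
  rewrite -[X in _ --> X](mul0r (u 0 i - zbar 0 i)); apply: cvgM; last exact: cvg_cst.
  rewrite -[X in _ --> X](subrr (dp (zbar 0 i))); apply: cvgB; last exact: cvg_cst.
  apply: (dp_cvg dp_cont Izi).
  exact: (@cvg_seg_param R R^o _ _ _ l_0).
have : - dot w0 (u - zbar) + (G zbar - G u) <= 0.
  exact: (ler_cvg_seq (cvgD (cvgN dg) (cvg_cst _)) sl0 bound).
lra.
Qed.
End Core.

(** * Extended-real-valued separable kernels *)

Lemma not_edom (R : realType) (T : Type) (F : T -> \bar R) (x : T) :
  ~ edom F x -> F x = +oo%E.
Proof. by rewrite /edom/= => /negP; rewrite -leNgt leye_eq => /eqP. Qed.

Lemma nbhs_other_point (R : realType) (B : set R) (s c : R) : nbhs c B ->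
  exists y, B y /\ y != s.
Proof.
move=> nB; have [<-|cs] := eqVneq c s; last first.
  by exists c; split=> //; exact: nbhs_singleton.
have [e /= e0 eB] := (nbhs_ballP _ _).1 nB.
exists (c + e / 2); split; last by rewrite gt_eqF// ltrDl divr_gt0.
apply: eB; rewrite /ball/= opprD addrA subrr sub0r normrN gtr0_norm ?divr_gt0//.
by rewrite gtr_pMr// invf_lt1 ?ltr1n.
Qed.

Section SeparableKernel.
Context {R : realType} {n : nat} (phi : R -> \bar R) (h : 'rV[R]_n -> \bar R).
Context (hE : forall x, h x = (\sum_(i < n) phi (x 0%R i))%E).
Context (phi_conv : strictly_econvex (phi : R^o -> \bar R)).

Local Notation I := (edom phi).
Local Notation p := (fine \o phi).

(** With a second point in the domain, strict convexity would put the midpoint value below [-oo]. *)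
Lemma edom_ninfty (x y : R) : phi x = -oo%E -> I y -> y = x.
Proof.
move=> phix Iy; apply: contrapT => /nesym/eqP xy.
have Ix : I x by rewrite /edom/= phix.
have h01 : 0 < (2^-1 : R) < 1 by rewrite invr_gt0 ltr0n invf_lt1 ?ltr1n.
have := phi_conv Ix Iy xy h01.
by rewrite phix gt0_muleNy ?lte_fin ?invr_gt0// addNye ltNge leNye.
Qed.

(** A neighbourhood of [c] supplies a second point of the domain. Below, [c] serves throughout as
    the witness that [phi] is real on its domain. *)
Lemma edom_fin_num (c x : R) : I° c -> I x -> phi x \is a fin_num.
Proof.
move=> Ic Ix; rewrite fin_numE; apply/andP; split; last by rewrite lt_eqF.
apply/eqP => phix; have [y [Iy /eqP]] := nbhs_other_point x Ic.
by apply; exact: edom_ninfty.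
Qed.

(* When [phi] takes the value -oo, its domain is a single point, and then [edom h]
   has empty interior, although -oo absorbs +oo in the sum defining [h]. *)
Lemma interior_coord (x : 'rV[R]_n) i : (edom h)° x -> I° (x 0 i).
Proof.
move=> [P nP sP].
have Pin j : P 0 j (x 0 j) by apply: nbhs_singleton; exact: nP.
(* If [phi s = -oo], then [phi] is [+oo] elsewhere, and a point of the neighbourhood avoiding [s] in
   all coordinates has [h = +oo]. *)
have [[s phis]|noNy] := pselect (exists s, phi s = -oo%E).
  have /choice[y yP] : forall j, exists r, P 0 j r /\ r != s.
    by move=> j; apply: nbhs_other_point; exact: nP.
  have : edom h (\row_j y j).
    by apply: sP => k j; rewrite mxE ord1; case: (yP j).
  have yoo j : phi (y j) = +oo%E.
    by apply: not_edom => /(edom_ninfty phis); apply/eqP; case: (yP j).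
  rewrite /edom/= hE; suff -> : (\sum_(j < n) phi ((\row_k y k) 0%R j))%E = +oo%E.
    by rewrite ltxx.
  apply/esum_eqyP => [j _|]; first by rewrite mxE yoo.
  by exists i; rewrite mem_index_enum mxE yoo.
(* Without the value [-oo], one infinite term makes the sum infinite, so it is enough to vary
   coordinate [i]. *)
apply: filterS (nP 0 i) => s Ps; apply: contrapT => nIs; have phis := not_edom nIs.
have : edom h (\row_j (if j == i then s else x 0 j)).
  by apply: sP => k j; rewrite mxE ord1; case: eqP => [->|_].
rewrite /edom/= hE; set S := (\sum_(_ < n) _)%E; suff -> : S = +oo%E by rewrite ltxx.
apply/esum_eqyP => [j _|]; last by exists i; rewrite mem_index_enum mxE eqxx.
by apply/eqP => phij; apply: noNy; eexists; exact: phij.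
Qed.

Lemma kernel_strict_convex (c : R) : I° c -> forall x y l : R, I x -> I y -> x != y ->
  0 < l < 1 ->
  I (l * x + (1 - l) * y) /\ p (l * x + (1 - l) * y) < l * p x + (1 - l) * p y.
Proof.
move=> Ic x y l Ix Iy xy l01; have := phi_conv Ix Iy xy l01.
have fx := edom_fin_num Ic Ix; have fy := edom_fin_num Ic Iy.
rewrite -[in X in (_ < X)%E](fineK fx) -[in X in (_ < X)%E](fineK fy).
rewrite -!EFinM -EFinD => lt.
have Iw : I (l * x + (1 - l) * y) by apply: lt_trans lt _; rewrite ltry.
split=> //; move: lt.
by rewrite -[X in (X < _)%E](fineK (edom_fin_num Ic Iw)) lte_fin.
Qed.

Lemma fin_num_phi (c : R) : I° c -> forall x, I x -> phi x = (p x)%:E.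
Proof. by move=> Ic x Ix; rewrite /= fineK// (edom_fin_num Ic). Qed.

Lemma hE_fin (c : R) : I° c -> forall x : 'rV[R]_n, (forall i, I (x 0 i)) ->
  h x = (\sum_(i < n) p (x 0 i))%:E.
Proof.
move=> Ic x Ix; rewrite hE -sumEFin; apply: eq_bigr => i _.
exact: fin_num_phi Ic _ _.
Qed.

Lemma edom_h (c : R) : I° c -> forall x : 'rV[R]_n, edom h x <-> forall i, I (x 0 i).
Proof.
move=> Ic x; split=> [hx i|Ix]; last by rewrite /edom/= (hE_fin Ic) ?ltry.
apply: contrapT => nI; have phiy := not_edom nI; move: hx; rewrite /edom/= hE.
suff -> : (\sum_(i < n) phi (x 0%R i))%E = +oo%E by rewrite ltxx.
apply/esum_eqyP => [j _|]; last by exists i; rewrite mem_index_enum.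
by apply/eqP => /edom_ninfty yj; have [y [/yj <-]] := nbhs_other_point (x 0 j) Ic; rewrite eqxx.
Qed.

Lemma interior_edom_h (c : R) : I° c -> forall x : 'rV[R]_n,
  (edom h)° x <-> forall i, I° (x 0 i).
Proof.
move=> Ic x; split=> [Sx i|Ix]; first exact: interior_coord.
exists (fun _ j => I) => [k j|y Iy]; first by rewrite ord1; exact: Ix.
by apply/(edom_h Ic) => i; exact: Iy.
Qed.

Lemma closure_coord (c : R) : I° c -> forall (x : 'rV[R]_n) i,
  closure (edom h) x -> closure I (x 0 i).
Proof.
move=> Ic x i clx B nB.
have [y [/(edom_h Ic)/(_ i) Iy By]] := clx _ (coord_continuous (i := 0) (j := i) nB).
by exists (y 0 i).
Qed.

(** Near an interior point [h] is a real sum, and the direction ['e_i] changes its [i]-th term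
    alone. *)
Lemma grad_h (c : R) : I° c -> forall (x : 'rV[R]_n) i, (edom h)° x ->
  grad (fine \o h) x 0 i = derive1 p (x 0 i).
Proof.
move=> Ic x i Sx; rewrite mxE.
rewrite (near_eq_derive (g := fun y : 'rV[R]_n => \sum_(j < n) p (y 0 j))); last first.
  apply: filterS Sx => y /(edom_h Ic) Iy.
  by rewrite /= (hE_fin Ic Iy).
rewrite /derive1 /derive; congr (lim (_ @ 0^')); apply/funext => s /=.
congr (_ *: _); rewrite -sumrB (bigD1 i)//= big1 ?addr0.
  by rewrite !mxE !eqxx mulr1.
by move=> j ji; rewrite !mxE eqxx (negbTE ji) mulr0 add0r subrr.
Qed.

Lemma bregmanE (c : R) : I° c -> forall y x, edom h y -> (edom h)° x ->
  bregman h y x = (breg p (derive1 p) y x)%:E.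
Proof.
move=> Ic y x hy Sx; rewrite /bregman.
rewrite (hE_fin Ic ((edom_h Ic _).1 hy)).
rewrite (hE_fin Ic ((edom_h Ic _).1 (interior_subset Sx))).
rewrite -!EFinB; congr (_%:E); rewrite /breg !sumrB; congr (_ - _).
by rewrite /dot; apply: eq_bigr => i _; rewrite (grad_h Ic)// !mxE.
Qed.

Lemma bregman_pinfty (c : R) : I° c -> forall y x, ~ edom h y -> (edom h)° x ->
  bregman h y x = +oo%E.
Proof.
move=> Ic y x hy Sx; rewrite /bregman.
by rewrite (not_edom hy) (hE_fin Ic ((edom_h Ic _).1 (interior_subset Sx))).
Qed.

End SeparableKernel.

(** * Gradients, limits of Lipschitz functions and projections *)

Lemma derive_grad (R : realType) (n : nat) (F : 'rV[R]_n -> R) (x d : 'rV[R]_n) :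
  differentiable F x -> 'D_d F x = dot (grad F x) d.
Proof.
move=> dF; rewrite deriveE// {1}(row_sum_delta d) linear_sum; apply: eq_bigr => i _.
by rewrite linearZ/= mxE deriveE// mulrC.
Qed.

Lemma lipschitz_cvg (R : realType) (n : nat) (X : set 'rV[R]_n) (F : 'rV[R]_n -> R)
    (y : nat -> 'rV[R]_n) (b : 'rV[R]_n) :
  [locally [lipschitz F x | x in X]] -> (forall k, X (y k)) -> X b ->
  y @ \oo --> b -> F (y k) @[k --> \oo] --> F b.
Proof.
move=> lipF Xy Xb yb.
(* Local Lipschitz continuity concerns pairs of points; it is used near the diagonal pair [(b, b)],
   with second entry [b]. *)
have /pinfty_ex_gt0[M M0 MF] := lipF (b, b) (conj Xb Xb).
have yb2 : (y k, b) @[k --> \oo] --> (b, b) by exact: (cvg_pair yb (cvg_cst b)).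
have near_lip : \forall k \near \oo, `|F (y k) - F b| <= M * `|y k - b|.
  by have := yb2 _ MF; apply: (@filterS _ \oo) => k Hk; exact: (Hk (conj (Xy k) Xb)).
apply/cvgrPdist_lt => e e0.
near=> k.
have h1 : `|F (y k) - F b| <= M * `|y k - b| by near: k.
rewrite distrC (le_lt_trans h1)// -ltr_pdivlMl// distrC.
by near: k; apply: cvgr_dist_lt => //; rewrite mulr_gt0 ?invr_gt0.
Unshelve. all: by end_near. Qed.

(** Zeroing the boundary coordinates minimizes every summand of the squared distance; a minimal sum
    forces equality in each summand, so [get] can only return this point. *)
Lemma euclidean_projE (R : realType) (n : nat) (phi : R -> \bar R) (x w : 'rV[R]_n) :
  euclidean_proj (tangent phi x) w =
  \row_i (if `[< bd_index phi x i >] then 0 else w 0 i).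
Proof.
rewrite /euclidean_proj; set q := \row_i _.
have Tq : tangent phi x q by move=> b Bb; rewrite mxE; case: asboolP.
have le_q u i : tangent phi x u ->
    (w - q) 0 i * (w - q) 0 i <= (w - u) 0 i * (w - u) 0 i.
  move=> Tu; rewrite !mxE; case: asboolP => [/Tu ->//|_].
  by rewrite subrr mulr0 -expr2 sqr_ge0.
have : argmin (tangent phi x) (fun p => (dot (w - p) (w - p))%:E)
    (get (argmin (tangent phi x) (fun p => (dot (w - p) (w - p))%:E))).
  apply: getPex; exists q; split=> // u Tu; rewrite lee_fin.
  by apply: ler_sum => i _; exact: le_q.
move: (get _) => u [Tu /(_ q Tq)]; rewrite lee_fin => ule.
have E : forall i, (w - q) 0 i * (w - q) 0 i = (w - u) 0 i * (w - u) 0 i.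
  have S0 : \sum_(i < n) ((w - u) 0 i * (w - u) 0 i - (w - q) 0 i * (w - q) 0 i) == 0.
    rewrite eq_le; apply/andP; split; first by rewrite sumrB subr_le0.
    by apply: sumr_ge0 => i _; rewrite subr_ge0; exact: le_q.
  move: S0; rewrite psumr_eq0 => [/allP S0 i|i _]; last by rewrite subr_ge0; exact: le_q.
  by have := S0 i (mem_index_enum i); rewrite subr_eq0 => /eqP.
apply/rowP => i; have := E i; rewrite !mxE; case: asboolP => [/Tu ->//|_].
by rewrite subrr mulr0 => /esym/eqP; rewrite mulf_eq0 orbb subr_eq0 => /eqP.
Qed.

Lemma convex_set_seg (R : realType) (V : lmodType R) (X : set V) (x y : V) (l : R) :
  @convex_set R V X -> X x -> X y -> 0 < l < 1 -> X (x + l *: (y - x)).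
Proof.
move=> cX Xx Xy /andP[l0 l1].
have := cX y x (Itv01 (ltW l0) (ltW l1)) (mem_set Xy) (mem_set Xx).
move=> /set_mem; congr X; change (l *: y + (1 - l) *: x = x + l *: (y - x)).
by rewrite scalerBr scalerBl scale1r addrCA.
Qed.

(** * The theorem *)

(** For compact [X] the sequence is bounded. Otherwise either some bound holds infinitely often,
    which gives a convergent selection, or the norms tend to infinity and coercivity contradicts
    [K]. *)
Lemma coercive_subseq (R : realType) (n : nat) (X : set 'rV[R]_n)
    (g h : 'rV[R]_n -> \bar R) (gamma : 'rV[R]_n -> 'rV[R]_n -> R) (tbar t K : R)
    (z y : nat -> 'rV[R]_n) (a : 'rV[R]_n) :
  surrogate_coercive X g h gamma tbar -> 0 < t <= tbar ->
  (forall k, ((edom h)° `&` X) (z k)) -> (forall k, ((edom h)° `&` X) (y k)) ->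
  X a -> z @ \oo --> a ->
  (forall k, (subproblem g h gamma t (z k) (y k) <= K%:E)%E) ->
  exists (s : nat -> nat) (b : 'rV[R]_n),
    (forall k, (k <= s k)%N) /\ y (s k) @[k --> \oo] --> b.
Proof.
move=> [cX|coer] tt Sz Sy Xa za yK.
  have /pinfty_ex_gt0[M _ XM] := compact_bounded cX.
  by apply: (@bounded_subseq _ _ _ M) => k; apply: XM; case: (Sy k).
have [[M nM]|bdd] := pselect (exists M, ~ \forall k \near \oo, ~ `|y k| <= M).
  have [r [rk rM]] := frequently_subseq nM.
  have [s [b [sk yb]]] := bounded_subseq rM.
  exists (r \o s), b; split=> // k /=; exact: leq_trans (sk k) (rk _).
have yoo : `|y k| @[k --> \oo] --> +oo.
  apply/cvgryPge => A; apply: contrapT => nA; apply: bdd; exists A => H; apply: nA.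
  by apply: filterS H => k /negP; rewrite -ltNge => /ltW.
have poo := coer t z y a tt Sz Sy yoo Xa za.
have : \forall k \near \oo, False.
  near=> k; have := yK k; apply/negP; rewrite -ltNge.
  by near: k; exact: cvgey_gt poo _.
by move=> /filter_ex[].
Unshelve. all: by end_near. Qed.

Theorem theorem3p1 (R : realType) (n : nat)
  (f : 'rV[R]_n -> R) (g : 'rV[R]_n -> \bar R)
  (phi : R -> \bar R) (h : 'rV[R]_n -> \bar R)
  (gamma : 'rV[R]_n -> 'rV[R]_n -> R)
  (X : set 'rV[R]_n) (tbar t : R) (zbar : 'rV[R]_n)
  (g_dom : edom g = X)
  (X_neq0 : X !=set0) (X_closed : closed X)
  (X_convex : @convex_set R 'rV[R]_n X)
  (f_C1 : continuously_differentiable_on X f)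
  (g_convex : econvex g) (g_lipschitz : elocally_lipschitz_on X g)
  (h_int : (edom h)° `&` X !=set0) (X_dom_h : X `<=` closure (edom h))
  (h_kernel : separable_kernel phi h)
  (gamma_cont : surrogate_continuous X gamma)
  (gamma_f : surrogate_consistent X f gamma)
  (tbar_gt0 : 0 < tbar)
  (gamma_convex : surrogate_strictly_convex X g h gamma tbar)
  (gamma_coercive : surrogate_coercive X g h gamma tbar)
  (t_range : 0 < t < tbar)
  (X_zbar : X zbar) :
  (forall z : nat -> 'rV[R]_n,
     (forall k, ((edom h)° `&` X) (z k)) -> z @ \oo --> zbar ->
     residual X g h gamma t (z k) @[k --> \oo] --> 0%E)
  <->
  [set manifold_grad phi zbar f zbar + v
     | v in manifold_subdiff phi zbar g zbar] 0.
Proof.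
(* In dimension 0 no coordinate can provide an interior point of [edom phi]; all vectors coincide
   and both statements hold. *)
have [n0|n_gt0] := posnP n.
  subst n.
  have allE (u v : 'rV[R]_0) : u = v by apply/rowP => -[].
  have h0 u : h u = 0%E by case: h_kernel => -> _ _ _; rewrite big_ord0.
  split=> _; last first.
    move=> z _ _; suff -> : (fun k => residual X g h gamma t (z k)) = cst 0%E by exact: cvg_cst.
    apply/funext => k; rewrite /residual /bregman !h0 /dot big_ord0.
    by rewrite oppe0 !adde0.
  exists 0; last exact: allE.
  split; first by case.
  move=> y _; rewrite (allE y zbar) /dot big_ord0 subee//.
  by apply: (g_lipschitz.1).
have [hE phi_der phi_bd phi_conv] := h_kernel.
case: h_int => x0 [Sx0 Xx0].
have Ic := interior_coord hE phi_conv (Ordinal n_gt0) Sx0.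
move: (x0 0 _) Ic => c Ic.
have [g_fin g_lip] := g_lipschitz.
have [ga_diff ga_cont _] := gamma_cont.
have [t0 ttbar] := andP t_range.
pose p := fine \o phi; pose dp := derive1 p; pose G := fine \o g.
pose I := edom phi.
have gE u : X u -> g u = (G u)%:E by move=> Xu; rewrite /G/= fineK// g_fin.
have p_conv := kernel_strict_convex phi_conv Ic.
have p_der s : I° s -> derivable p s 1 /\ 'D_1 p s = dp s.
  by move=> Is; split; [case: (phi_der _ Is)|rewrite /dp derive1E].
have dp_cont s : I° s -> {for s, continuous dp} by move=> /phi_der[].
have X_conv x y l : X x -> X y -> 0 < l < 1 -> X (x + l *: (y - x)).
  exact: convex_set_seg.
have X_clI x i : X x -> closure I (x 0 i).
  by move=> /X_dom_h; exact: (closure_coord hE phi_conv Ic).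
have ga_der x y d : X x -> X y -> derivable (gamma^~ x) y d.
  by move=> Xx Xy; apply: diff_derivable; exact: ga_diff.
have ga_cvg (z y : nat -> 'rV[R]_n) a b : (forall k, X (z k)) -> (forall k, X (y k)) ->
    X a -> X b -> z @ \oo --> a -> y @ \oo --> b ->
    gamma (y k) (z k) @[k --> \oo] --> gamma b a.
  move=> Xz Xy Xa Xb za yb.
  have zy : (z k, y k) @[k --> \oo] --> (a, b) by exact: (cvg_pair za yb).
  have Xab : (X `*` X) (a, b) by split.
  have Xzy k : (X `*` X) (z k, y k) by split; [exact: Xz|exact: Xy].
  exact: (within_continuous_cvg ga_cont Xab Xzy zy).
have G_conv x y l : X x -> X y -> 0 < l < 1 -> G (x + l *: (y - x)) <= G x + l * (G y - G x).
  move=> Xx Xy l01.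
  have := g_convex y x l; rewrite g_dom => /(_ Xy Xx l01).
  have -> : l *: y + (1 - l) *: x = x + l *: (y - x).
    by rewrite scalerBr scalerBl scale1r addrCA.
  rewrite (gE _ Xx) (gE _ Xy) gE ?lee_fin; last exact: X_conv.
  by move=> /le_trans; apply; lra.
have G_cvg (y : nat -> 'rV[R]_n) b : (forall k, X (y k)) -> X b -> y @ \oo --> b ->
    G (y k) @[k --> \oo] --> G b by exact: lipschitz_cvg.
have innerE x : inner I X x <-> ((edom h)° `&` X) x.
  split=> [[Xx Ix]|[Ix Xx]]; split=> //; first by apply/(interior_edom_h hE phi_conv Ic).
  exact/(interior_edom_h hE phi_conv Ic).
have subE x y : inner I X x -> feasible I X y ->
    subproblem g h gamma t x y = (model p dp gamma G t y x)%:E.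
  move=> /innerE[Sx Xx] [Xy Iy]; rewrite /subproblem (gE _ Xy).
  have hy : edom h y by exact/(edom_h hE phi_conv Ic).
  by rewrite (bregmanE hE phi_conv Ic hy Sx) -EFinM -!EFinD.
have subNE x y : inner I X x -> X y -> ~ feasible I X y ->
    subproblem g h gamma t x y = +oo%E.
  move=> /innerE[Sx Xx] Xy nFy; rewrite /subproblem (gE _ Xy).
  have hy : ~ edom h y by move=> /(edom_h hE phi_conv Ic) Iy; apply: nFy; split.
  by rewrite (bregman_pinfty hE phi_conv Ic hy Sx) gt0_muley ?lte_fin ?invr_gt0// -EFinD addey.
have coercive (z y : nat -> 'rV[R]_n) a K : (forall k, inner I X (z k)) ->
    (forall k, inner I X (y k)) -> X a -> z @ \oo --> a ->
    (forall k, model p dp gamma G t (y k) (z k) <= K) ->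
    exists (s : nat -> nat) (b : 'rV[R]_n),
      (forall k, (k <= s k)%N) /\ y (s k) @[k --> \oo] --> b.
  move=> Sz Sy Xa za yK; apply: (@coercive_subseq _ _ X g h gamma tbar t K z y a) => //.
  - by rewrite t0 ltW.
  - by move=> k; apply/innerE.
  - by move=> k; apply/innerE.
  - by move=> k; rewrite subE ?lee_fin//; exact: inner_feasible.
pose T := update X g h gamma t.
(* [get] is meaningful only for a nonempty argmin: the minimizer over feasible points is one over
   [X], since infeasible points have value [+oo]. *)
have T_argmin x : inner I X x -> feasible I X (T x) /\
    forall u, feasible I X u -> model p dp gamma G t (T x) x <= model p dp gamma G t u x.
  move=> Sx; have Fx := inner_feasible Sx.
  have [y [Sy ymin]] := exists_minimizer p_conv p_der dp_cont phi_bd X_closed X_conv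
    X_clI ga_der ga_cvg G_conv G_cvg t0 coercive Sx.
  have Fy := inner_feasible Sy.
  have [XT Tmin] : argmin X (subproblem g h gamma t x) (T x).
    apply: getPex; exists y; split=> [|u Xu]; first by case: Fy.
    rewrite subE//; have [Fu|nFu] := pselect (feasible I X u).
      by rewrite subE// lee_fin ymin.
    by rewrite subNE// leey.
  have FT : feasible I X (T x).
    apply: contrapT => nFT; have := Tmin _ Fx.1.
    by rewrite subNE// subE// leye_eq.
  by split=> // u Fu; have := Tmin _ Fu.1; rewrite !subE// lee_fin.
have T_inner x : inner I X x -> inner I X (T x).
  move=> Sx; have [FT Tmin] := T_argmin x Sx.
  exact: (feasible_minimizer_inner p_conv p_der dp_cont phi_bd X_conv
    X_clI ga_der ga_cvg G_conv G_cvg t0 Sx FT Tmin).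
have T_min x u : inner I X x -> feasible I X u ->
    model p dp gamma G t (T x) x <= model p dp gamma G t u x.
  by move=> Sx; have [_ +] := T_argmin x Sx; apply.
have kconv (x y z : 'rV[R]_n) l : X x -> inner I X y -> inner I X z -> 0 < l < 1 ->
    kernel_model p gamma G tbar x (z + l *: (y - z)) <=
      kernel_model p gamma G tbar x z +
      l * (kernel_model p gamma G tbar x y - kernel_model p gamma G tbar x z).
  move=> Xx Sy Sz l01; set F := kernel_model p gamma G tbar x.
  have [->|yz] := eqVneq y z; first by rewrite !subrr scaler0 mulr0 !addr0.
  have FE u : feasible I X u ->
      (tbar%:E * ((gamma u x)%:E + g u) + h u)%E = (F u)%:E.
    by move=> [Xu Iu]; rewrite (gE _ Xu) (hE_fin hE phi_conv Ic Iu) -EFinD.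
  have Fy := FE _ (inner_feasible Sy); have Fz := FE _ (inner_feasible Sz).
  have Sw : inner I X (z + l *: (y - z)).
    by apply: (inner_seg p_conv) => //; case: Sz.
  have := gamma_convex x Xx y z l.
  have -> : l *: y + (1 - l) *: z = z + l *: (y - z).
    by rewrite scalerBr scalerBl scale1r addrCA.
  rewrite Fy Fz (FE _ (inner_feasible Sw)) /edom/= Fy Fz !ltry => /(_ isT isT yz l01).
  by rewrite -!EFinM -EFinD lte_fin => /ltW/le_trans; apply; lra.
have Sx0' : inner I X x0 by apply/innerE.
pose w0 := grad f zbar.
have ga_grad d : 'D_d (gamma^~ zbar) zbar = dot w0 d.
  have [gradE _] := gamma_f zbar X_zbar.
  by rewrite (derive_grad _ (ga_diff _ _ X_zbar X_zbar)) gradE.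
have resE x : inner I X x -> residual X g h gamma t x = (breg p dp (T x) x)%:E.
  move=> Sx; have [hx _] := (innerE x).1 Sx.
  have hT : edom h (T x).
    by apply/(edom_h hE phi_conv Ic); exact: (inner_feasible (T_inner _ Sx)).2.
  exact: (bregmanE hE phi_conv Ic).
pose m := manifold_grad phi zbar f zbar.
have mE d : tangent phi zbar d -> dot m d = dot w0 d.
  move=> Td; apply: eq_bigr => i _; rewrite /m /manifold_grad euclidean_projE mxE.
  by case: asboolP => [/Td ->|//]; rewrite !mulr0.
have man_tan u : manifold phi zbar u -> tangent phi zbar (u - zbar).
  by move=> Mu b /Mu ub; rewrite !mxE ub subrr.
have dotN d : dot (- m) d = - dot m d.
  by rewrite /dot -sumrN; apply: eq_bigr => i _; rewrite mxE mulNr.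
(* The only candidate subgradient is [- m]. Against tangent vectors [m] acts as [w0], and off [X]
   the inequality is trivial because [g] is [+oo], so the face suffices. *)
have stationaryE : [set m + v | v in manifold_subdiff phi zbar g zbar] 0 <->
    forall u, face I X zbar u -> 0 <= dot w0 (u - zbar) + G u - G zbar.
  split=> [[v [_ vsub] mv] u [Xu Mu]|stat].
    have vE : v = - m by apply/eqP; rewrite -addr_eq0 addrC mv.
    have := vsub u Mu; rewrite (gE _ Xu) (gE _ X_zbar) -EFinB lee_fin vE dotN mE.
      lra.
    exact: man_tan.
  exists (- m); last by rewrite subrr.
  split=> [b Bb|u Mu].
    by rewrite /m /manifold_grad euclidean_projE !mxE; case: asboolP => // _; rewrite oppr0.
  have [Xu|nXu] := pselect (X u); last first.
    have -> : g u = +oo%E by apply: not_edom; rewrite g_dom.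
    by rewrite (gE _ X_zbar) leey.
  rewrite (gE _ Xu) (gE _ X_zbar) -EFinB lee_fin dotN mE; last exact: man_tan.
  by have := stat u (conj Xu Mu); lra.
rewrite stationaryE; split=> [stop|stat].
  apply: (breg_cvg0_face_stationary p_conv p_der dp_cont phi_bd X_closed X_conv
    X_clI ga_der ga_cvg G_conv G_cvg t0 coercive T_inner T_min X_zbar ga_grad Sx0') => z Sz zz.
  have Sz' k : ((edom h)° `&` X) (z k) by apply/innerE.
  have -> : (fun k => breg p dp (T (z k)) (z k)) =
      fine \o (fun k => residual X g h gamma t (z k)).
    by apply/funext => k; rewrite /= resE.
  exact: fine_cvg (stop z Sz' zz).
move=> z Sz zz.
have Sz' k : inner I X (z k) by apply/innerE.
have -> : (fun k => residual X g h gamma t (z k)) = (fun k => (breg p dp (T (z k)) (z k))%:E).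
  by apply/funext => k; rewrite resE.
apply: cvg_EFin; first exact: nearW.
exact: (face_stationary_breg_cvg0 p_conv p_der phi_bd X_closed X_conv
    X_clI ga_der ga_cvg G_cvg t0 ttbar coercive T_inner T_min kconv X_zbar ga_grad).
Qed.
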